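(* Let $k \geq 4$ be an integer, and let $G$ be a $1$-tough and $(k-1)$-connected $(P_2 \cup kP_1)$-free graph. Then every longest cycle of $G$ is an edge-dominating cycle of $G$.
   Context: All graphs are finite and simple. For a graph $G$ and $S \subset V(G)$, $\omega(G-S)$ denotes the number of components of $G-S$. A graph $G$ is $1$-tough if $|S| \ge \omega(G-S)$ for every $S \subset V(G)$ with $\omega(G-S) \ge 2$ (complete graphs are $1$-tough). $P_2 \cup kP_1$ denotes the disjoint union of a single edge and $k$ isolated vertices; $G$ is $(P_2 \cup kP_1)$-free if it has no induced subgraph isomorphic to $P_2 \cup kP_1$. A cycle $C$ of $G$ is an edge-dominating cycle if every component of $G - V(C)$ consists of exactly one vertex. *)

(* Defs.v *)
From mathcomp Require Import all_boot.

Set Implicit Arguments.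
Unset Strict Implicit.
Unset Printing Implicit Defensive.

Record sgraph := SGraph {
  vertex :> finType;
  adj : rel vertex;
  adj_sym : symmetric adj;
  adj_irr : irreflexive adj
}.

Section InducedSubgraph.
Variables (G : sgraph) (A : {set G}).

Definition induced_rel : rel {x : G | x \in A} :=
  fun x y => adj (val x) (val y).

Lemma induced_sym : symmetric induced_rel.
Proof. by move=> x y; apply: adj_sym. Qed.

Lemma induced_irr : irreflexive induced_rel.
Proof. by move=> x; apply: adj_irr. Qed.

Definition induced : sgraph := SGraph induced_sym induced_irr.
End InducedSubgraph.

(* G - S *)
Definition del_vertices (G : sgraph) (S : {set G}) : sgraph := induced (~: S).

Definition components (G : sgraph) : {set {set G}} :=
  equivalence_partition (connect (@adj G)) [set: G].

Definition omega (G : sgraph) : nat := #|components G|.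

Definition connected (G : sgraph) : Prop := omega G = 1.

(* The complete graph on n vertices is (n-1)-connected and not n-connected. *)
Definition kconnected (k : nat) (G : sgraph) : Prop :=
  k < #|G| /\ forall S : {set G}, #|S| < k -> connected (del_vertices S).

Definition one_tough (G : sgraph) : Prop :=
  forall S : {set G},
    2 <= omega (del_vertices S) -> omega (del_vertices S) <= #|S|.

Definition isomorphic (G H : sgraph) : Prop :=
  exists2 f : G -> H, bijective f & forall x y, adj (f x) (f y) = adj x y.

Definition free_of (H G : sgraph) : Prop :=
  forall A : {set G}, ~ isomorphic (induced A) H.

Section PathGraph.
Variable n : nat.

Definition path_rel : rel 'I_n :=
  fun i j => (i.+1 == j :> nat) || (j.+1 == i :> nat).

Lemma path_rel_sym : symmetric path_rel.
Proof. by move=> i j; rewrite /path_rel orbC. Qed.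

Lemma path_rel_irr : irreflexive path_rel.
Proof. by move=> i; rewrite /path_rel orbb gtn_eqF. Qed.

Definition path_graph : sgraph := SGraph path_rel_sym path_rel_irr.
End PathGraph.

Section DisjointUnion.
Variables G H : sgraph.

Definition union_rel : rel (G + H)%type := fun u v =>
  match u, v with
  | inl x, inl y => adj x y
  | inr x, inr y => adj x y
  | _, _ => false
  end.

Lemma union_rel_sym : symmetric union_rel.
Proof. by case=> x [] y //=; apply: adj_sym. Qed.

Lemma union_rel_irr : irreflexive union_rel.
Proof. by case=> x /=; apply: adj_irr. Qed.

Definition disjoint_union : sgraph := SGraph union_rel_sym union_rel_irr.
End DisjointUnion.

Section Copies.
Variables (k : nat) (G : sgraph).

Definition copies_rel : rel ('I_k * G)%type :=
  fun u v => (u.1 == v.1) && adj u.2 v.2.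

Lemma copies_rel_sym : symmetric copies_rel.
Proof. by move=> u v; rewrite /copies_rel eq_sym adj_sym. Qed.

Lemma copies_rel_irr : irreflexive copies_rel.
Proof. by move=> u; rewrite /copies_rel adj_irr andbF. Qed.

(* kG, the disjoint union of k copies of G *)
Definition copies : sgraph := SGraph copies_rel_sym copies_rel_irr.
End Copies.

Definition P2_kP1 (k : nat) : sgraph :=
  disjoint_union (path_graph 2) (copies k (path_graph 1)).

(* A cycle is given by the list of its vertices in cyclic order; its length is
   the size of the list. [ucycle] alone also accepts [::] and single edges. *)
Definition is_cycle (G : sgraph) (c : seq G) : Prop :=
  ucycle (@adj G) c /\ 3 <= size c.

Definition longest_cycle (G : sgraph) (c : seq G) : Prop :=
  is_cycle c /\ forall c' : seq G, is_cycle c' -> size c' <= size c.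

Definition edge_dominating_cycle (G : sgraph) (c : seq G) : Prop :=
  is_cycle c /\
  forall D, D \in components (del_vertices [set x in c]) -> #|D| = 1.

(* Main.v *)
(* Write t = k - 1, let C be a longest cycle and suppose that some component H of G - C
   has an edge.  Put A = N(H) and let X be the set of successors of A on C.  Connectivity
   and (P2 u kP1)-freeness give |A| = t, any two vertices of A are joined by a path with
   at least two vertices inside H, at most t vertices outside A and H are independent,
   and fewer than t of them are if they also avoid the closed neighbourhood of an edge
   lying outside A and H.  Rerouting C through H, with one vertex of slack, shows that
   apart from its last vertex each segment of C - A sees no vertex of X but its own
   first one, and dually; hence the segments are cliques and the only edges between
   two different segments are chords from the last vertex of one to the first vertex of
   another.  A chord excludes so many neighbours in A of some clique that its
   neighbourhood has fewer than t vertices.  So there is no chord, and deleting A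
   leaves the t segments and H as separate components, against toughness. *)

Require Import Defs.
From mathcomp Require Import all_boot.
From mathcomp Require Import zify.

Set Implicit Arguments.
Unset Strict Implicit.
Unset Printing Implicit Defensive.

(** A rerouting is a contradiction once it gains more vertices than it drops. The path through H has
    at least two vertices, so one vertex of C may be dropped, and this single unit of slack is why
    second successors of A behave almost like first ones. The obstacle is an edge from an inner
    vertex w of the segment after a to the successor of another b in A: rerouting along it loses all
    vertices between a and w. The second vertex of that stretch is therefore moved elsewhere on the
    cycle, between two consecutive vertices that it sees, again and again until two are left. For
    this reason the lemmas speak of every cycle of maximum length that contains A and avoids H, not
    of C alone. Independent sets are handled as functions on A, so that one member can be exchanged
    while the others stay in place, and (P2 u kP1)-freeness becomes a domination property. The bound
    k >= 4 gives |A| >= 3, hence a third segment besides the two that a chord joins. *)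

Notation "x -- y" := (adj x y) (at level 30).

(** Makes distinctness of a rerouted vertex list a family of inequalities between multiplicities,
    blind to the order and direction of its pieces. *)
Lemma uniq_countP (T : eqType) (s : seq T) :
  reflect (forall x, count_mem x s <= 1) (uniq s).
Proof.
apply: (iffP idP) => [us x|]; first by rewrite count_uniq_mem // leq_b1.
elim: s => //= x s IH le1; rewrite IH => [|y]; last first.
  by apply: leq_trans (le1 y); rewrite leq_addl.
have := le1 x; rewrite eqxx add1n ltnS leqn0 => /eqP c0.
by rewrite -has_pred1 has_count c0.
Qed.

(** * Cyclic lists *)

Section Next.
Variable T : eqType.
Implicit Types (s l : seq T) (x y v : T).

Lemma next_mid l1 x y l2 : uniq (l1 ++ x :: y :: l2) ->
  next (l1 ++ x :: y :: l2) x = y.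
Proof.
move=> U; rewrite -(next_rot (size l1) U) rot_size_cat /=.
by rewrite eqxx.
Qed.

Lemma next_end y l x : uniq (y :: rcons l x) -> next (y :: rcons l x) x = y.
Proof.
move=> U; rewrite -(next_rot (size (y :: l)) U).
by rewrite -cats1 -cat_cons rot_size_cat /= eqxx.
Qed.

Lemma next_insert l1 v l2 x y0 : x != v -> x != last y0 l1 ->
  next (y0 :: l1 ++ v :: l2) x = next (y0 :: l1 ++ l2) x.
Proof.
move=> xv; suff E y1 y : x != last y l1 ->
    next_at x y1 y (l1 ++ v :: l2) = next_at x y1 y (l1 ++ l2) by exact: E.
elim: l1 y => [|z l1 IH] y /=; last by move=> /IH ->.
by move=> /negbTE xy; case: l2 => [|z l2] /=; rewrite xy (negbTE xv).
Qed.

Lemma split2 (l : seq T) x y : x \in l -> y \in l -> x != y ->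
  exists l1 l2 l3, l = l1 ++ x :: l2 ++ y :: l3 \/ l = l1 ++ y :: l2 ++ x :: l3.
Proof.
move=> /splitPr [l1 l2]; rewrite mem_cat inE eq_sym => + /negbTE xy.
rewrite xy /= => /orP [] /splitPr [m1 m2].
  by exists m1, m2, l2; right; rewrite -catA.
by exists l1, m1, m2; left.
Qed.

Lemma rot_split2 (c : seq T) x y : x \in c -> y \in c -> x != y ->
  exists i l1 l2, rot i c = x :: l1 ++ y :: l2.
Proof.
move=> /rot_to [i p E] yc xy; exists i; rewrite E.
have : y \in x :: p by rewrite -E mem_rot.
rewrite inE eq_sym (negbTE xy) /= => /splitPr [l1 l2].
by exists l1, l2.
Qed.
End Next.

(** * Walks in a graph *)

Section Walks.
Variable G : sgraph.
Implicit Types (x y u v : G) (s t : seq G).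

(* [s] is the full vertex list, both ends included; [walk x [::] y] is false. *)
Definition walk x s y :=
  if s is z :: s' then [&& z == x, path (@adj G) z s' & last z s' == y] else false.

Lemma walk1 x : walk x [:: x] x.
Proof. by rewrite /= !eqxx. Qed.

Lemma walkE x s y : walk x s y ->
  exists s', [/\ s = x :: s', path (@adj G) x s' & last x s' = y].
Proof. by case: s => //= z s /and3P [/eqP -> P /eqP L]; exists s. Qed.

Lemma walk_path x s : path (@adj G) x s -> walk x (x :: s) (last x s).
Proof. by move=> /= ->; rewrite !eqxx. Qed.

Lemma walk_cat x s y u t v : walk x s y -> y -- u -> walk u t v -> walk x (s ++ t) v.
Proof.
move=> /walkE [s' [-> P E]] yu /walkE [t' [-> P' E']] /=.
by rewrite eqxx cat_path P last_cat /= E yu P' E' eqxx.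
Qed.

Lemma walk_rev x s y : walk x s y -> walk y (rev s) x.
Proof.
move=> /walkE [s' [-> P E]]; rewrite lastI rev_rcons E.
rewrite -rev_path in P.
have {}P : path (@adj G) (last x s') (rev (belast x s')).
  by apply: sub_path P => u v /=; rewrite adj_sym.
rewrite E in P; rewrite /= P !eqxx /=.
by case: (s') E => [|z r] /= E; rewrite ?E // rev_cons last_rcons.
Qed.

Lemma walk_cycle x s y : walk x s y -> y -- x -> cycle (@adj G) s.
Proof. by move=> /walkE [s' [-> P E]] yx; rewrite /= rcons_path P E. Qed.

Lemma walk_split x s t y : s != [::] -> t != [::] -> walk x (s ++ t) y ->
  exists u v, [/\ walk x s u, u -- v & walk v t y].
Proof.
case: s => // z s _; case: t => // w t _ /walkE [r [[-> <-]]].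
rewrite cat_path last_cat /= => /and3P [P e P'] <-.
by exists (last x s), w; split => //; apply: walk_path.
Qed.

Lemma walk_tail x u z t y : walk x (u :: z :: t) y -> u -- z /\ walk z (z :: t) y.
Proof. by case/and3P=> _ /= /andP [e P] L; rewrite e /= eqxx P. Qed.

Lemma cycle_walk s : s != [::] -> cycle (@adj G) s ->
  exists x y, walk x s y /\ y -- x.
Proof.
case: s => // x s _ /=; rewrite rcons_path => /andP [P e].
by exists x, (last x s); split => //; apply: walk_path.
Qed.

Lemma walk_head x y s z : walk x (y :: s) z -> y = x.
Proof. by case/and3P => /eqP. Qed.

Lemma walk_split_cons x s z t y : s != [::] -> walk x (s ++ z :: t) y ->
  exists u, [/\ walk x s u, u -- z & walk z (z :: t) y].
Proof.
move=> n0 /(@walk_split _ _ (_ :: _) _ n0 isT) [u [v [g1 e g2]]].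
by exists u; have E := walk_head g2; subst v.
Qed.

Lemma walk_last x y s z : walk x (rcons s y) z -> z = y.
Proof. by move/walk_rev; rewrite rev_rcons => /walk_head. Qed.

Lemma walk_mem x s y : walk x s y -> (x \in s) && (y \in s).
Proof. by move=> /walkE [s' [-> _ <-]]; rewrite inE eqxx mem_last. Qed.

Lemma clique_walk s x y : {in s &, forall u v, u != v -> u -- v} ->
  x \in s -> y \in s -> x != y -> uniq s -> exists2 r, perm_eq r s & walk x r y.
Proof.
move=> cl xs ys xy us; exists (x :: rcons (rem y (rem x s)) y).
  rewrite perm_sym (perm_trans (perm_to_rem xs)) // perm_cons.
  rewrite perm_sym perm_rcons perm_sym perm_to_rem //.
  by rewrite mem_rem_uniq // inE eq_sym xy.
set r := rem _ _; have : {subset r <= s} by move=> z /mem_rem /mem_rem.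
have : x \notin r.
  by apply/negP => /mem_rem; rewrite mem_rem_uniq // inE eqxx.
have : y \notin r by rewrite mem_rem_uniq ?rem_uniq // inE eqxx.
have ur : uniq r by rewrite !rem_uniq.
move: r ur => r ur yr xr rs; rewrite /= eqxx last_rcons eqxx andbT /=.
elim: r x xs xy ur yr xr rs => [|z r IH] x xs xy /=.
  by move=> *; rewrite cl.
case/andP=> zr ur; rewrite !inE !negb_or => /andP [yz yr] /andP [xz xr] rs.
have zs : z \in s by apply: rs; rewrite inE eqxx.
rewrite cl //= IH // 1?eq_sym // => u ur'; apply: rs.
by rewrite inE ur' orbT.
Qed.
End Walks.

(** Both tactics turn counts or sizes into arbitrary naturals and clear the context, so the facts
    they may use have to stand in the goal as premises. *)
Ltac cntlia :=
  do 6 (rewrite ?(count_cat, count_rev) /=);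
  repeat match goal with |- context [@count ?T ?f ?s] => generalize (@count T f s); intro end;
  repeat match goal with |- context [nat_of_bool ?b] => generalize (nat_of_bool b); intro end;
  clear; lia.
Ltac szlia :=
  do 6 (rewrite ?(size_cat, size_rev, size_rcons) /=);
  repeat match goal with |- context [@size ?T ?s] => generalize (@size T s); intro end;
  clear; lia.

(** * Rerouting a longest cycle through H *)

Section Base.
Variables (G : sgraph) (N : nat) (H A : {set G}).
Local Notation W := (~: (A :|: H)).

Implicit Types (a b x y u v w z : G) (c s p q l P Q R Z F : seq G).

(** A class instead of one cycle: rotation, reversal and the relocation of a vertex stay inside it,
    with [A] and [H] fixed. *)
Definition good (c : seq G) :=
  [/\ uniq c, cycle (@adj G) c, size c = N, {subset A <= c}
    & {in c, forall v, v \notin H}].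

Lemma in_W v : (v \in W) = (v \notin A) && (v \notin H).
Proof. by rewrite !inE negb_or. Qed.

Lemma notin_W a : a \in A -> a \notin W.
Proof. by move=> aA; rewrite in_W aA. Qed.

Lemma neq_AW a v : a \in A -> v \in W -> a != v.
Proof. by move=> aA vW; apply/eqP => E; move: vW; rewrite -E (negbTE (notin_W aA)). Qed.

Lemma adj_neq u v : u -- v -> u != v.
Proof. by move=> e; apply/eqP => E; rewrite E adj_irr in e. Qed.

Lemma link_uniq c s : uniq c -> {in c, forall v, v \notin H} ->
  uniq s -> {subset s <= H} -> uniq (c ++ s).
Proof.
move=> uc cH us sH; rewrite cat_uniq uc us andbT /=.
by apply/hasPn => v /sH vH; apply/negP => /cH; rewrite vH.
Qed.

Lemma good_rot n c : good c -> good (rot n c).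
Proof.
case=> u cy s Ac cH; split; rewrite ?rot_uniq ?rot_cycle ?size_rot //.
  by move=> v; rewrite mem_rot; apply: Ac.
by move=> v; rewrite mem_rot; apply: cH.
Qed.

Lemma good_rev c : good c -> good (rev c).
Proof.
case=> u cy s Ac cH; split; rewrite ?rev_uniq ?size_rev //.
- case: c cy {u s Ac cH} => // z c cy.
  have [x [y [g e]]] := @cycle_walk _ (z :: c) isT cy.
  by rewrite (walk_cycle (walk_rev g)) 1?adj_sym.
- by move=> v; rewrite mem_rev; apply: Ac.
by move=> v; rewrite mem_rev; apply: cH.
Qed.

Lemma next_rotE n c : uniq c -> next (rot n c) =1 next c.
Proof. by move=> u v; rewrite next_rot. Qed.

Lemma arc2 c a b : uniq c -> cycle (@adj G) c -> a \in c -> b \in c -> a != b ->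
  exists P R, [/\ walk (next c a) P b, walk (next c b) R a & perm_eq (P ++ R) c].
Proof.
move=> u cy ac bc ab; have [i [l1 [l2 E]]] := rot_split2 ac bc ab.
exists (rcons l1 b), (rcons l2 a).
have pe : rot 1 (rot i c) = rcons l1 b ++ rcons l2 a.
  by rewrite E /= rot1_cons -cats1 -!catA /= -!cats1 -!catA.
have : cycle (@adj G) (rcons l1 b ++ rcons l2 a) by rewrite -pe !rot_cycle.
have n0 q x : rcons q x != [::] by case: q.
move=> /cycle_walk []; first by case: (l1).
move=> x [y [g e]]; have [u' [v [g1 e' g2]]] := walk_split (n0 _ _) (n0 _ _) g.
have U : uniq (a :: l1 ++ b :: l2) by rewrite -E rot_uniq.
have -> : next c a = x.
  rewrite -(next_rotE i u) E /=; by have := g1; case: (l1) => [|z l] /walk_head -> /=; rewrite eqxx.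
have -> : next c b = v.
  rewrite -(next_rotE i u) E; have := g2; case: (l2) U => [|z l] U /walk_head <-.
    by have := @next_end _ a l1 b; rewrite -cats1 => ->.
  by have := @next_mid _ (a :: l1) b z l U.
have E1 := walk_last g1; have E2 := walk_last g2; subst; split=> //.
by rewrite -pe !perm_rot.
Qed.

Hypothesis N3 : 2 < N.
Hypothesis longest : forall s : seq G,
  uniq s -> cycle (@adj G) s -> 2 < size s -> size s <= N.
(** One vertex inside [H] is enough here: this section yields the bound on [#|A|] from which the
    two-vertex paths of [link] are derived. *)
Hypothesis link1 : forall a b, a \in A -> b \in A -> a != b ->
  exists u s v, [/\ walk u s v, a -- u, v -- b, uniq s & {subset s <= H}].

Lemma too_long l x y : walk x l y -> y -- x -> uniq l -> N < size l -> False.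
Proof.
move=> g e u lN; have := longest u (walk_cycle g e) (ltn_trans N3 lN).
by rewrite leqNgt lN.
Qed.

(** Follow [c] from [next c b] to [a], cross [H] to [b], go backwards to [next c a] and close with
    the supposed edge: all of [c] is kept and a vertex of [H] gained. *)
Lemma next_indep c a b : good c -> a \in A -> b \in A -> a != b ->
  ~~ next c a -- next c b.
Proof.
case=> u cy sc Ac cH aA bA ab; apply/negP => e1.
have [P [R [gP gR pe]]] := arc2 u cy (Ac _ aA) (Ac _ bA) ab.
have [x [s [y [gs e e' us sH]]]] := link1 aA bA ab.
have ss : 0 < size s by case: (s) gs.
have U := link_uniq u cH us sH.
apply: (too_long (walk_cat gR e (walk_cat gs e' (walk_rev gP))) e1).
  apply/uniq_countP => z; move/uniq_countP: U => /(_ z); have := permP pe (pred1 z).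
  cntlia.
by move: ss sc (perm_size pe); szlia.
Qed.

Lemma rot_next c a : good c -> a \in c ->
  exists i p, rot i c = [:: a, next c a, next c (next c a) & p].
Proof.
case=> u cy sc Ac cH ac; have [i p E] := rot_to ac.
have U : uniq (a :: p) by rewrite -E rot_uniq.
have S : size (a :: p) = N by rewrite -E size_rot.
case: p E U S => [|x [|y p]] E U S; try by move: S N3 => /= <-.
exists i, p; rewrite -!(next_rotE i u) E /= !eqxx.
by case: eqP U => [->|_ _] //; rewrite /= inE eqxx.
Qed.

Lemma no_consecutive c a b p : good c -> c = a :: b :: p -> a \in A -> b \in A -> False.
Proof.
case=> u cy sc Ac cH E aA bA; rewrite E in u cy cH sc.
have ab : a != b by move: u; rewrite /= inE negb_or -andbA => /andP [].
have [x [s [y [gs e e' us sH]]]] := link1 aA bA ab.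
have ss : 0 < size s by case: (s) gs.
have U := link_uniq u cH us sH.
have /= := cy; rewrite rcons_path => /and3P [_ P e2].
apply: (too_long (walk_cat (walk1 a) e (walk_cat gs e' (walk_path P))) e2).
  by apply/uniq_countP => z; move/uniq_countP: U => /(_ z); cntlia.
by move: ss sc; szlia.
Qed.

Lemma next_W c a : good c -> a \in A -> next c a \in W.
Proof.
move=> g aA; have [u cy sc Ac cH] := g.
rewrite in_W cH ?mem_next ?Ac // andbT; apply/negP => bA.
have [i [p E]] := rot_next g (Ac _ aA).
exact: no_consecutive (good_rot i g) E aA bA.
Qed.

End Base.
Arguments notin_W {G H A a}.

(** * Systems of representatives and second successors *)

Section Core.
Variables (G : sgraph) (N : nat) (H A : {set G}).
Local Notation W := (~: (A :|: H)).

(* In the application [A] is the neighbourhood of a component [H] of [G - c]. *)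
Definition rep_system (f : G -> G) :=
  {in A, forall a, f a \in W} /\
  {in A &, forall a b, a != b -> f a != f b /\ ~~ f a -- f b}.

Hypothesis N3 : 2 < N.
Hypothesis A3 : 2 < #|A|.
Hypothesis longest : forall s : seq G,
  uniq s -> cycle (@adj G) s -> 2 < size s -> size s <= N.
Hypothesis link : forall a b, a \in A -> b \in A -> a != b ->
  exists u s v, [/\ walk u s v, a -- u, v -- b, 1 < size s
                  & uniq s /\ {subset s <= H}].
Hypothesis AH : [disjoint A & H].
(** Otherwise [u], the values of [f] and an edge of [H] induce the forbidden graph. In [dom_edge]
    the extra independent vertex comes from [H] and the edge is [z -- z']. *)
Hypothesis dom : forall f, rep_system f -> forall u, u \in W ->
  exists2 a, a \in A & (u == f a) || u -- f a.
Hypothesis dom_edge : forall f, rep_system f -> forall z z', z \in W -> z' \in W ->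
  z -- z' -> exists2 a, a \in A & [|| f a == z, f a == z', f a -- z | f a -- z'].

Hypothesis nbrH : forall v h, h \in H -> v -- h -> v \in A :|: H.
Hypothesis conn : forall S : {set G}, S \subset W -> S != set0 ->
  #|A| <= #|[set v | (v \notin S) && [exists s in S, s -- v]]|.
Hypothesis tough : one_tough G.

Implicit Types (a b x y u v w z : G) (c s p q l P Q R Z F : seq G).

Local Notation good := (good N H A).

Let neq_AW a v : a \in A -> v \in W -> a != v.
Proof. exact: neq_AW. Qed.

Let link1 a b : a \in A -> b \in A -> a != b ->
  exists u s v, [/\ walk u s v, a -- u, v -- b, uniq s & {subset s <= H}].
Proof.
move=> aA bA /(link aA bA) [u [s [v [gs e1 e2 _ [us sH]]]]].
by exists u, s, v.
Qed.

Let too_long l x y : walk x l y -> y -- x -> uniq l -> N < size l -> False.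
Proof. exact: (too_long N3 longest). Qed.

Let next_indep c a b : good c -> a \in A -> b \in A -> a != b -> ~~ next c a -- next c b.
Proof. exact: (next_indep N3 longest link1). Qed.

Let rot_next c a : good c -> a \in c ->
  exists i p, rot i c = [:: a, next c a, next c (next c a) & p].
Proof. exact: (rot_next N3). Qed.

Let next_W c a : good c -> a \in A -> next c a \in W.
Proof. exact: (next_W N3 longest link1). Qed.

(* The rerouted cycle also picks up [v] and at least two vertices of [H]. *)
Lemma connector_bound c a b v : uniq c -> cycle (@adj G) c ->
  {in c, forall v, v \notin H} -> a \in A -> b \in A -> a \in c -> b \in c ->
  a != b -> v \notin c -> v \notin H -> next c a -- v -> v -- next c b ->
  size c + 3 <= N.
Proof.
move=> u cy cH aA bA ac bc ab vc vH e1 e2.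
have [P [R [gP gR pe]]] := arc2 u cy ac bc ab.
have [x [s [y [gs e e' ss [us sH]]]]] := link aA bA ab.
have U := link_uniq u cH us sH.
rewrite leqNgt; apply/negP => lN.
apply: (too_long (walk_cat gR e (walk_cat gs e' (walk_cat (walk_rev gP) e1 (walk1 v)))) e2).
  have vs : count_mem v s = 0 by apply/count_memPn/negP => /sH; rewrite (negbTE vH).
  have vc' : count_mem v c = 0 by apply/count_memPn.
  apply/uniq_countP => z; move/uniq_countP: U => /(_ z); have := permP pe (pred1 z).
  case: (altP (v =P z)) => [<-|vz]; first by move: vs vc'; rewrite !count_cat /= eqxx; cntlia.
  by rewrite !count_cat /= (negbTE vz); cntlia.
by move: lN ss (perm_size pe); szlia.
Qed.

(** The detour through [H] would replace the single vertex [x] by at least two. *)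
Lemma no_distance_two c a x b p : good c -> c = [:: a, x, b & p] -> a \in A -> b \in A -> False.
Proof.
case=> u cy sc Ac cH E aA bA; rewrite E in u cy cH sc.
have ab : a != b by move: u; rewrite /= !inE !negb_or -!andbA => /and3P [].
have [x' [s [y [gs e e' ss [us sH]]]]] := link aA bA ab.
have U := link_uniq u cH us sH.
have /= := cy; rewrite rcons_path => /and4P [_ _ P e2].
apply: (too_long (walk_cat (walk1 a) e (walk_cat gs e' (walk_path P))) e2).
  by apply/uniq_countP => z; move/uniq_countP: U => /(_ z); cntlia.
by move: ss sc; szlia.
Qed.

Lemma next2_W c a : good c -> a \in A -> next c (next c a) \in W.
Proof.
move=> g aA; have [u cy sc Ac cH] := g.
rewrite in_W cH ?mem_next ?Ac // andbT; apply/negP => bA.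
have [i [p E]] := rot_next g (Ac _ aA).
exact: no_distance_two (good_rot i g) E aA bA.
Qed.

Lemma next_repsys c : good c -> rep_system (next c).
Proof.
move=> g; have [u _ _ _ _] := g; split=> [a|a b aA bA ab]; first exact: next_W.
split; last exact: next_indep.
by apply: contra ab => /eqP /(can_inj (prev_next u)) ->.
Qed.

Lemma next_walk l b R h y : uniq (l ++ b :: R) -> walk h R y -> next (l ++ b :: R) b = h.
Proof. by case: R => // z R U /walk_head <-; apply: next_mid. Qed.

Lemma cycle_split l1 l2 : l1 != [::] -> l2 != [::] -> cycle (@adj G) (l1 ++ l2) ->
  exists x1 y1 x2 y2, [/\ walk x1 l1 y1, y1 -- x2, walk x2 l2 y2 & y2 -- x1].
Proof.
move=> n1 n2 /cycle_walk [|x [y [g e]]]; first by case: (l1) n1.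
by have [u [v [g1 e1 g2]]] := walk_split n1 n2 g; exists x, u, v, y.
Qed.

(** The rerouting of [next_indep] with [next c a] left out; the second vertex of [H] pays for it. *)
Lemma next2_indep c a b : good c -> a \in A -> b \in A -> a != b ->
  ~~ next c b -- next c (next c a).
Proof.
move=> g aA bA ab; apply/negP => e1; have [u cy sc Ac cH] := g.
have [i [p E]] := rot_next g (Ac _ aA).
have bp : b \in p.
  have := Ac _ bA; rewrite -(mem_rot i) E !inE eq_sym (negbTE ab).
  by rewrite (negbTE (neq_AW bA (next_W g aA))) (negbTE (neq_AW bA (next2_W g aA))).
have [x [s [y [gs e e' ss [us sH]]]]] := link aA bA ab.
have := link_uniq u cH us sH; have := permEl (perm_rot i c).
case/splitPr: bp E => p1 p2 E.
(* Rotated once more so that the vertex to be dropped stands alone in front. *)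
have E1 : rot 1 (rot i c) = [:: next c a] ++ (next c (next c a) :: rcons p1 b) ++ rcons p2 a.
  by rewrite E rot1_cons /= -!cats1 -!catA.
have cy1 : cycle (@adj G) (rot 1 (rot i c)) by rewrite !rot_cycle.
have U1 : uniq (rot 1 (rot i c)) by rewrite !rot_uniq.
have nb : next (rot 1 (rot i c)) b = next c b by rewrite !next_rotE ?rot_uniq.
rewrite E1 in cy1 U1 nb.
have n0 q z : rcons q z != [::] by case: q.
have [x1 [y1 [x2 [y2 [g1 _ + _]]]]] := @cycle_split [:: _] ((_ :: _) ++ _) isT isT cy1.
move=> /(@walk_split _ _ (_ :: _) _ _ isT (n0 p2 a)) [b' [h [g2 _ g3]]].
have Eb : b' = b := @walk_last _ _ _ (_ :: p1) _ g2.
have Ey : y2 = a := walk_last g3.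
have Ex : x2 = next c (next c a) by rewrite (walk_head g2).
have Eh : next c b = h.
  have EL : [:: next c a] ++ (next c (next c a) :: rcons p1 b) ++ rcons p2 a =
    [:: next c a, next c (next c a) & p1] ++ b :: rcons p2 a by rewrite /= cat_rcons.
  by rewrite -nb EL; apply: next_walk g3; rewrite -EL.
subst b' y2 x2 h.
move=> /permP pe U.
apply: (too_long (walk_cat g3 e (walk_cat gs e' (walk_rev g2)))); first by rewrite adj_sym.
  apply/uniq_countP => z; move/uniq_countP: U => /(_ z); move: (pe (pred1 z)).
  by rewrite E -!cats1; cntlia.
by move: ss sc; rewrite -(size_rot i c) E; szlia.
Qed.

(** The condition under which [u] may replace [f a] in a representative system [f]. *)
Definition excl (f : G -> G) a u :=
  forall b, b \in A -> b != a -> u != f b /\ ~~ f b -- u.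

(** With [u] in place of [f a] the system still dominates [v], and exclusivity of [v] leaves [u] as
    its only possible neighbour there. *)
Lemma clique_of f a u v : rep_system f -> a \in A -> u \in W -> v \in W ->
  excl f a u -> excl f a v -> u != v -> u -- v.
Proof.
move=> [fW fI] aA uW vW xu xv uv.
have [] := @dom (fun b => if b == a then u else f b) _ v vW.
  split=> [b bA|b b' bA b'A bb']; first by case: eqP => // _; apply: fW.
  case: (altP (b =P a)) => [E|ba]; case: (altP (b' =P a)) => [E'|b'a].
  - by rewrite E E' eqxx in bb'.
  - by have [h1 h2] := xu _ b'A b'a; rewrite h1 adj_sym h2.
  - by have [h1 h2] := xu _ bA ba; rewrite eq_sym h1 h2.
  exact: fI.
move=> b bA; case: (altP (b =P a)) => [_|ba].
  by rewrite eq_sym (negbTE uv) /= adj_sym.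
by have [h1 h2] := xv _ bA ba; rewrite (negbTE h1) adj_sym (negbTE h2).
Qed.

Lemma next2_excl c a : good c -> a \in A -> excl (next c) a (next c (next c a)).
Proof.
move=> g aA b bA ba; have [u _ _ _ _] := g; split; last first.
  by apply: next2_indep => //; rewrite eq_sym.
apply/eqP => /(can_inj (prev_next u)) E; have := next_W g aA.
by rewrite E (negbTE (notin_W bA)).
Qed.

(** A missed [v] sees some [next c a]. By [connector_bound] it sees no other successor of [A], so
    [clique_of] makes it adjacent to [next c (next c a)] too, and it fits between these two. *)
Lemma mem_good c v : good c -> v \notin H -> v \in c.
Proof.
move=> g vH; apply/negPn/negP => vc; have [u cy sc Ac cH] := g.
have vA : v \notin A by apply: contra vc; apply: Ac.
have vW : v \in W by rewrite in_W vA.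
have [a aA] := dom (next_repsys g) vW.
have /negbTE -> /= : v != next c a.
  by apply: contra vc => /eqP ->; rewrite mem_next Ac.
move=> e; have xv : excl (next c) a v.
  move=> b bA ba; split; first by apply: contra vc => /eqP ->; rewrite mem_next Ac.
  apply/negP => e'; rewrite adj_sym in e; rewrite eq_sym in ba; rewrite adj_sym in e'.
  have := connector_bound u cy cH aA bA (Ac _ aA) (Ac _ bA) ba vc vH e e'.
  by rewrite sc -[leqRHS]addn0 leq_add2l.
have e2 : v -- next c (next c a).
  apply: (clique_of (next_repsys g) aA vW (next2_W g aA) xv (next2_excl g aA)).
  by apply: contra vc => /eqP ->; rewrite !mem_next; apply: Ac.
have [i [p E]] := rot_next g (Ac _ aA).
have := cy; rewrite -(rot_cycle i) E /= rcons_path => /and4P [e3 e4 P e5].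
rewrite adj_sym in e.
apply: (too_long (walk_cat (walk_cat (walk1 a) e3 (walk1 (next c a))) e (walk_cat (walk1 v) e2 (walk_path P))) e5).
  apply/uniq_countP => z; have vc' : count_mem v c = 0 by apply/count_memPn.
  move/uniq_countP: u => /(_ z); have := permP (permEl (perm_rot i c)) (pred1 z).
  rewrite E; case: (altP (v =P z)) => [<-|vz].
    by move: vc'; rewrite !count_cat /= eqxx; cntlia.
  by rewrite !count_cat /= (negbTE vz); cntlia.
by move: sc; rewrite -(size_rot i c) E; szlia.
Qed.

(** * Predecessors, by reversing the cycle *)

Lemma next_rev_prev c : good c -> next (rev c) =1 prev c.
Proof. by case=> u _ _ _ _ v; rewrite next_rev. Qed.

Lemma prev_W c a : good c -> a \in A -> prev c a \in W.
Proof. by move=> g aA; rewrite -next_rev_prev //; apply: next_W => //; apply: good_rev. Qed.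

Lemma prev2_W c a : good c -> a \in A -> prev c (prev c a) \in W.
Proof. by move=> g aA; rewrite -!next_rev_prev //; apply: next2_W => //; apply: good_rev. Qed.

Lemma eq_excl f f' a u : {in A, f =1 f'} -> excl f a u -> excl f' a u.
Proof. by move=> E x b bA ba; rewrite -E //; apply: x. Qed.

Lemma prev_repsys c : good c -> rep_system (prev c).
Proof.
move=> g; have [h1 h2] := next_repsys (good_rev g).
by split=> [a /h1|a b aA bA /(h2 _ _ aA bA)]; rewrite !next_rev_prev.
Qed.

Lemma prev2_excl c a : good c -> a \in A -> excl (prev c) a (prev c (prev c a)).
Proof.
move=> g aA b bA ba; have := next2_excl (good_rev g) aA bA ba.
by rewrite !next_rev_prev.
Qed.

(** * Moving one vertex along the cycle *)

Lemma cycle_remove y0 l1 v z l2 : cycle (@adj G) (y0 :: l1 ++ v :: z :: l2) ->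
  last y0 l1 -- z -> cycle (@adj G) (y0 :: l1 ++ z :: l2).
Proof.
by rewrite /= !rcons_cat !cat_path /= => /and4P [-> _ _ ->] ->.
Qed.

Lemma cycle_insert y0 l1 v z l2 : cycle (@adj G) (y0 :: l1 ++ z :: l2) ->
  last y0 l1 -- v -> v -- z -> cycle (@adj G) (y0 :: l1 ++ v :: z :: l2).
Proof.
by rewrite /= !rcons_cat !cat_path /= => /and3P [-> _ ->] -> ->.
Qed.

(** The three vertices whose successor changes will lie outside [A], so the move preserves the
    successors of [A] and with them exclusivity. *)
Lemma relocate a l1 v z m y r : good (a :: l1 ++ v :: z :: m ++ y :: r) ->
  last a l1 -- z -> last z m -- v -> v -- y ->
  good (a :: l1 ++ z :: m ++ v :: y :: r) /\
  forall d, d != v -> d != last a l1 -> d != last z m ->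
    next (a :: l1 ++ z :: m ++ v :: y :: r) d = next (a :: l1 ++ v :: z :: m ++ y :: r) d.
Proof.
move=> [u cy sc Ac cH] e1 e2 e3.
have pe : perm_eq (a :: l1 ++ z :: m ++ v :: y :: r) (a :: l1 ++ v :: z :: m ++ y :: r).
  by apply/permP => f; cntlia.
have L : last a (l1 ++ z :: m) = last z m by rewrite last_cat.
split.
  split; rewrite ?(perm_uniq pe) ?(perm_size pe) //.
  - have := cycle_remove cy e1; rewrite -[z :: m ++ _]/((z :: m) ++ _) catA => cy'.
    have -> : l1 ++ z :: m ++ v :: y :: r = (l1 ++ z :: m) ++ v :: y :: r by rewrite -catA.
    by apply: cycle_insert cy' _ e3; rewrite L.
  - by move=> d /Ac; rewrite (perm_mem pe).
  by move=> d; rewrite (perm_mem pe); apply: cH.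
move=> d dv d1 d2; rewrite (@next_insert _ l1 v) //.
have -> : l1 ++ z :: m ++ v :: y :: r = (l1 ++ z :: m) ++ v :: y :: r by rewrite -catA.
by rewrite next_insert // ?L // -catA.
Qed.

Lemma walk_rcons_path y l z : path (@adj G) y (rcons l z) ->
  exists h, walk h (rcons l z) z /\ y -- h.
Proof.
case: l => [|h l] /=; first by rewrite andbT => e; exists z; rewrite !eqxx.
by case/andP=> e P; exists h; rewrite eqxx P last_rcons eqxx.
Qed.

(** A passage from [p] to [p'] through one or both of [x], [u], hence with at most one of them
    dropped. The inequality for all [f] says that [r] repeats nothing, in the form [cntlia] uses. *)
Lemma clique2_path (x u p p' : G) : x -- u -> p -- x || p -- u -> p' -- x || p' -- u ->
  exists r y r', [/\ walk y r r', p -- y, r' -- p', 0 < size r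
    & forall f, count f r <= count f [:: x; u]].
Proof.
move=> e; have e' : u -- x by rewrite adj_sym.
rewrite ![p' -- _]adj_sym => /orP [] h1 /orP [] h2.
- by exists [:: x], x, x; split=> //= [|f]; rewrite ?eqxx //; lia.
- exists [:: x; u], x, u; split=> //=; rewrite ?eqxx ?e //.
- exists [:: u; x], u, x; split=> //= [|f]; rewrite ?eqxx ?e' //; lia.
- by exists [:: u], u, u; split=> //= [|f]; rewrite ?eqxx //; lia.
Qed.

Lemma prev_split c l1 x y l2 : uniq c -> c = l1 ++ x :: y :: l2 -> prev c y = x.
Proof.
move=> u E; have <- : next c x = y by rewrite E next_mid // -E.
exact: prev_next.
Qed.

Lemma prev_last c a l1 y l2 : uniq c -> c = a :: l1 ++ y :: l2 -> prev c y = last a l1.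
Proof.
move=> u E; apply: (@prev_split _ (belast a l1) _ _ l2) => //.
by rewrite E -[RHS]cat_rcons -lastI.
Qed.

Lemma next_in_W l1 z l2 f r : uniq (l1 ++ z :: l2 ++ f :: r) ->
  {in l2, forall y, y \in W} -> f \in W -> next (l1 ++ z :: l2 ++ f :: r) z \in W.
Proof.
case: l2 => [|y l2] U l2W fW; first by rewrite next_mid.
by rewrite next_mid // l2W // inE eqxx.
Qed.

(* The case of [no_early_cross] with exactly two vertices before [w].  Rerouting the
   cycle through [xb -- w] and [H] frees the edge [x -- u] without shortening the
   cycle, so [x -- u] behaves like a component off a longest cycle: the vertices
   [prev c j], moved one step back when they see [x] or [u], are independent and
   anticomplete to [x -- u]. *)
Section EarlyCross.
Variables (c : seq G) (a x u w f b xb : G) (F q : seq G).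
Hypothesis g : good c.
Hypothesis E : c = [:: a, x, u, w, f & F ++ [:: b, xb & q]].
Hypotheses (aA : a \in A) (bA : b \in A) (xW : x \in W) (uW : u \in W)
  (wW : w \in W) (fW : f \in W) (exbw : xb -- w).

Let nbr (p : G) := p -- x || p -- u.

(** Elsewhere it could only lie in [q]. Then [w .. b], [H], [j .. a], a passage through [x], [u],
    and the way back from [prev c j] to [xb] close up by [xb -- w], dropping at most one vertex. *)
Lemma nbr_in_F j : j \in A -> nbr (prev c j) -> prev c j \in f :: F.
Proof.
move=> jA nj; have [U cy sc Ac cH] := g.
have yW := prev_W g jA; set y := prev c j in nj yW *.
have ny : next c y = j by rewrite next_prev.
have ab : b != a.
  by apply/eqP => ba; move: U; rewrite E ba /= !inE mem_cat !inE eqxx !orbT.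
have nW z : next c z \in W -> z == y = false.
  by move=> h; apply/eqP => zy; rewrite zy ny (negbTE (notin_W jA)) in h.
have yc : y \in c by rewrite mem_prev Ac.
have U' := U; rewrite E in U'.
have h1 : next c x \in W by rewrite E (@next_mid _ [:: a] x u).
have h2 : next c u \in W by rewrite E (@next_mid _ [:: a; x] u w).
have h3 : next c w \in W by rewrite E (@next_mid _ [:: a; x; u] w f).
have h4 : next c xb \in W.
  suff -> : xb = next c b by exact: next2_W.
  by rewrite E; symmetry; apply: (@next_mid _ [:: a, x, u, w, f & F] b xb).
have := yc; rewrite {1}E !inE mem_cat !inE.
rewrite !(eq_sym y) (negbTE (neq_AW aA yW)) (negbTE (neq_AW bA yW)) /=.
rewrite (nW _ h1) (nW _ h2) (nW _ h3) (nW _ h4) /=.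
rewrite (eq_sym f) orbA => /orP [//|yq]; exfalso.
case/splitPr: yq {U' nW} E => q1 q2 E'.
have := cy; rewrite E' /= !rcons_cat !cat_path /= !rcons_cat !cat_path /=.
case/and5P=> eax exu euw ewf /and5P [pF eFb ebx pq1] /andP [eqy pq2].
have [h [gq2 eyh]] := walk_rcons_path pq2.
have jh : j = h.
  have EL : rot 1 c = [:: x, u, w, f & F ++ [:: b, xb & q1]] ++ y :: rcons q2 a.
    by rewrite E' rot1_cons /= -!cats1 -!catA /= -!catA.
  by rewrite -ny -(next_rotE 1 U) EL; apply: next_walk gq2; rewrite -EL rot_uniq.
subst h.
have bj : b != j.
  apply/eqP => bj; have : j \in rcons q2 a by have /andP[] := walk_mem gq2.
  rewrite -bj mem_rcons inE (negbTE ab) /= => bq2.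
  move/uniq_countP: U => /(_ b); have := count_memPn; rewrite E'.
  have : 0 < count_mem b q2 by rewrite -has_count has_pred1.
  by move=> h _; move: h; do 6 (rewrite ?count_cat /=); rewrite eqxx; cntlia.
have [s1 [s [s2 [gs e1 e2 ss [us sH]]]]] := link bA jA bj.
have UU := link_uniq U cH us sH.
have nx : nbr a by rewrite /nbr eax.
have [r [y1 [r' [gr e3 e4 sr cr]]]] := clique2_path exu nx nj.
have gq1 : walk xb (rcons (xb :: q1) y) y.
  by rewrite -cats1; apply: (walk_cat (walk_path pq1) eqy (walk1 y)).
apply: (too_long (walk_cat (walk_cat (walk_path (x := w) (s := f :: F) _) eFb (walk1 b)) e1
  (walk_cat gs e2 (walk_cat gq2 e3 (walk_cat gr e4 (walk_rev gq1))))) exbw).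
- by rewrite /= ewf.
- apply/uniq_countP => z; move/uniq_countP: UU => /(_ z); move: (cr (pred1 z)).
  by rewrite E' -!cats1; cntlia.
by move: ss sr sc; rewrite E'; szlia.
Qed.

Lemma base_pieces : [/\ a -- x, x -- u & w -- f] /\
  [/\ path (@adj G) f F, last f F -- b, path (@adj G) xb q & last xb q -- a].
Proof.
have [_ cy _ _ _] := g; have := cy; rewrite E /= !rcons_cat !cat_path /= !rcons_path.
by case/and5P=> -> -> _ -> /and4P [-> -> _ /andP [-> ->]].
Qed.

(** The rerouted cycle is [w .. b], [H], [a], then [q] backwards to [xb]. It makes up for the loss
    of [x] and [u], so neither fits between two consecutive vertices of it. *)
Lemma nbr_prev j : j \in A -> nbr (prev c j) -> ~~ nbr (prev c (prev c j)).
Proof.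
move=> jA nj; apply/negP => nj'; have [U cy sc Ac cH] := g.
have yF := nbr_in_F jA nj; have [[eax exu ewf] [pF eFb pq eqa]] := base_pieces.
have {}pF : path (@adj G) w (f :: F) by rewrite /= ewf.
have {}eFb : last w (f :: F) -- b by [].
have E' : c = [:: a, x, u, w & (f :: F) ++ [:: b, xb & q]] by rewrite E.
move: nj nj' yF E' pF eFb; set y := prev c j; move: (f :: F) => F' nj nj' yF.
case/splitPr: yF => F1 F2 E'.
rewrite cat_path last_cat /= => /and3P [p1 _ p2] eFb.
have Ey : prev c y = last w F1.
  apply: (@prev_last _ a ([:: x, u, w & F1]) y) => //.
  by rewrite E' -catA.
rewrite Ey in nj'.
have ba : b != a.
  by apply/eqP => ba; move: U; rewrite E' ba /= !inE mem_cat !inE eqxx !orbT.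
have [s1 [s [s2 [gs e1 e2 ss [us sH]]]]] := link bA aA ba.
have UU := link_uniq U cH us sH.
have [r [y1 [r' [gr e3 e4 sr cr]]]] := clique2_path exu nj' nj.
rewrite adj_sym in eqa.
apply: (too_long (walk_cat (walk_path p1) e3 (walk_cat gr e4 (walk_cat (walk_path p2) eFb
  (walk_cat (walk1 b) e1 (walk_cat gs e2 (walk_cat (walk1 a) eqa (walk_rev (walk_path pq)))))))) exbw).
  apply/uniq_countP => z; move/uniq_countP: UU => /(_ z); move: (cr (pred1 z)).
  by rewrite E'; cntlia.
by move: ss sr sc; rewrite E'; szlia.
Qed.

(** The crossing of [next_indep], mirrored, on the rerouted cycle with [x -- u] in the role of
    [H]. *)
Lemma nbr_prev_indep i j : i \in A -> j \in A -> i != j ->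
  nbr (prev c i) -> nbr (prev c j) -> ~~ prev c (prev c i) -- prev c (prev c j).
Proof.
move=> iA jA ij ni nj; apply/negP => ee; have [U cy sc Ac cH] := g.
have ij' : prev c i != prev c j by apply: contra ij => /eqP /(can_inj (next_prev U)) ->.
have yiF := nbr_in_F iA ni; have yjF := nbr_in_F jA nj.
have [[eax exu ewf] [pF eFb pq eqa]] := base_pieces.
have {}pF : path (@adj G) w (f :: F) by rewrite /= ewf.
have {}eFb : last w (f :: F) -- b by [].
have E' : c = [:: a, x, u, w & (f :: F) ++ [:: b, xb & q]] by rewrite E.
have ba : b != a.
  by apply/eqP => ba; move: U; rewrite E' ba /= !inE mem_cat !inE eqxx !orbT.
have [s1 [s [s2 [gs e1 e2 ss [us sH]]]]] := link bA aA ba.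
have UU := link_uniq U cH us sH.
rewrite adj_sym in eqa.
move: pF eFb E' ij' yiF yjF; move: (f :: F) => F' pF eFb E' ij' yiF yjF.
have [l1 [l2 [l3 EF]]] := split2 yiF yjF ij'.
wlog EF' : i j iA jA ij ni nj ee ij' yiF yjF EF / F' = l1 ++ prev c i :: l2 ++ prev c j :: l3.
  move=> hw; case: EF => EF; first by apply: (hw i j) => //; left.
  by apply: (hw j i) => //; first [rewrite eq_sym | rewrite adj_sym | left].
move: EF' ni nj ee; set y := prev c i; set y' := prev c j => EF' ni nj ee.
have Ey : prev c y = last w l1.
  apply: (@prev_last _ a ([:: x, u, w & l1]) y) => //.
  by rewrite E' EF' -catA.
have Ey' : prev c y' = last y l2.
  have -> : last y l2 = last a ([:: x, u, w & l1] ++ y :: l2) by rewrite last_cat.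
  by apply: prev_last => //; rewrite E' EF' /= -!catA /= -!catA.
rewrite Ey Ey' in ee.
move: pF eFb; rewrite EF' !cat_path !last_cat /= !cat_path last_cat /=.
case/and3P=> p1 _ /and3P [p2 _ p3] eFb.
have [r [y1 [r' [gr e3 e4 sr cr]]]] := clique2_path exu ni nj.
apply: (too_long (walk_cat (walk_path p1) ee (walk_cat (walk_rev (walk_path p2)) e3 (walk_cat gr e4
  (walk_cat (walk_path p3) eFb
  (walk_cat (walk1 b) e1 (walk_cat gs e2 (walk_cat (walk1 a) eqa (walk_rev (walk_path pq))))))))) exbw).
  apply/uniq_countP => z; move/uniq_countP: UU => /(_ z); move: (cr (pred1 z)).
  by rewrite E' EF'; cntlia.
by move: ss sr sc; rewrite E' EF'; szlia.
Qed.

Lemma no_early_cross_base : False.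
Proof.
have [U cy sc Ac cH] := g; have [[eax exu ewf] _] := base_pieces.
pose r j := if nbr (prev c j) then prev c (prev c j) else prev c j.
have [p1 p2] := prev_repsys g.
have nr j : j \in A -> ~~ nbr (r j).
  by move=> jA; rewrite /r; case: ifP => [|->] // /nbr_prev; apply.
have pp : injective (prev c) by exact: can_inj (next_prev U).
have rs : rep_system r.
  split=> [j jA|i j iA jA ij]; first by rewrite /r; case: ifP => _; rewrite ?prev2_W ?prev_W.
  rewrite /r; case: ifP => ni; case: ifP => nj.
  - split; first by apply: contra ij => /eqP /pp /pp ->.
    exact: nbr_prev_indep.
  - rewrite eq_sym in ij; have [h1 h2] := prev2_excl g iA jA ij.
    by rewrite h1 adj_sym h2.
  - have [h1 h2] := prev2_excl g jA iA ij.
    by rewrite eq_sym h1 h2.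
  exact: p2.
have [j jA] := dom_edge rs xW uW exu.
have /negbTE := nr _ jA; rewrite /nbr => /norP [/negbTE -> /negbTE ->].
rewrite !orbF /r.
(* From [r j] one or two steps forward lead to [j] in [A], but from [x] and [u] both steps stay in
   [W]. *)
have nx v : v \in c -> next c v \in W -> next c (next c v) \in W -> (r j == v) = false.
  move=> vc h1 h2; apply/negP => /eqP; rewrite /r; case: ifP => _ Ev; move: h1 h2.
    by rewrite -Ev !next_prev // (negbTE (notin_W jA)).
  by rewrite -Ev next_prev // (negbTE (notin_W jA)).
have U' := U; rewrite E in U'.
have Ex : next c x = u by rewrite E (@next_mid _ [:: a] x u).
have Eu : next c u = w by rewrite E (@next_mid _ [:: a; x] u w).
have Ew : next c w = f by rewrite E (@next_mid _ [:: a; x; u] w f).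
by rewrite -/(r j) !nx ?Eu ?Ew ?Ex ?Eu // E !inE eqxx ?orbT.
Qed.
End EarlyCross.

(* Induction on the number of vertices of [Z]: the second vertex [v] of a long [Z] is
   adjacent to [prev c d] for exactly one [d], hence also to the vertex before it,
   and can be relocated between these two. *)
Lemma no_early_cross n c a Z w f F b xb q : good c ->
  c = a :: Z ++ [:: w, f & F ++ [:: b, xb & q]] -> size Z = n -> a \in A -> b \in A ->
  {in Z, forall z, z \in W /\ excl (next c) a z} ->
  w \in W -> f \in W -> xb -- w -> False.
Proof.
elim: n c Z f F q => [|n IH] c Z f F q g E sZ aA bA ZP wW fW exw; have [U cy sc Ac cH] := g.
  case: Z sZ ZP E => // _ _ E.
  have Ea : next c a = w by rewrite E /= eqxx.
  have Eb : next c b = xb.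
    by have U' := U; rewrite E in U'; rewrite E (@next_mid _ [:: a, w, f & F] b xb).
  have ba : b != a by apply/eqP => ba; move: U; rewrite E ba /= !inE mem_cat !inE eqxx !orbT.
  by have := next_indep g bA aA ba; rewrite Ea Eb exw.
case: Z sZ ZP E => // x [|v [|z2 Z3]] sZ ZP E.
- have Eb : next c b = xb.
    by have U' := U; rewrite E in U'; rewrite E (@next_mid _ [:: a, x, w, f & F] b xb).
  have ab : a != b by apply/eqP => ba; move: U; rewrite E ba /= !inE mem_cat !inE eqxx !orbT.
  have := next2_indep g aA bA ab; rewrite Eb.
  have -> : next c a = x by rewrite E /= eqxx.
  have -> : next c x = w by have U' := U; rewrite E in U'; rewrite E (@next_mid _ [:: a] x w).
  by rewrite exw.
- apply: (no_early_cross_base g E) => //.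
  + by case: (ZP x); rewrite ?inE ?eqxx.
  + by case: (ZP v); rewrite ?inE ?eqxx ?orbT.
have [xW xx] : x \in W /\ excl (next c) a x by apply: ZP; rewrite inE eqxx.
have [vW xv] : v \in W /\ excl (next c) a v by apply: ZP; rewrite !inE eqxx orbT.
have [z2W xz2] : z2 \in W /\ excl (next c) a z2 by apply: ZP; rewrite !inE eqxx !orbT.
have U' := U; rewrite E in U'.
have xz2' : x != z2.
  by apply/eqP => xz; move: U'; rewrite /= xz !inE eqxx !orbT /= andbF.
have exz2 : x -- z2 := clique_of (next_repsys g) aA xW z2W xx xz2 xz2'.
have nv : next c v = z2 by rewrite E (@next_mid _ [:: a; x] v z2).
have [d dA] := dom (prev_repsys g) vW.
have vp d' : d' \in A -> v == prev c d' = false.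
  move=> d'A; apply/eqP => Ev; have := z2W.
  by rewrite -nv Ev next_prev // (negbTE (notin_W d'A)).
rewrite vp //= => evd.
set c0 := a :: x :: z2 :: Z3 ++ [:: w, f & F ++ [:: b, xb & q]].
have pe : perm_eq c (v :: c0) by apply/permP => h; rewrite E /c0; cntlia.
have Uv : uniq (v :: c0) by rewrite -(perm_uniq pe).
have /andP [vc0 U0] := Uv.
have cy0 : cycle (@adj G) c0.
  by have cy' := cy; rewrite E in cy'; apply: (@cycle_remove a [:: x] v _ _ cy').
have Ac0 d' : d' \in A -> d' \in c0.
  move=> d'A; have := Ac _ d'A; rewrite (perm_mem pe) inE.
  by rewrite (negbTE (neq_AW d'A vW)).
have pc0 d' : d' \in A -> next (rev c0) d' = prev c d'.
  move=> d'A; rewrite -next_rev_prev // E /c0.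
  have -> : rev [:: a, x, z2 & Z3 ++ [:: w, f & F ++ [:: b, xb & q]]] =
    rev (z2 :: Z3 ++ [:: w, f & F ++ [:: b, xb & q]]) ++ [:: x; a].
    by rewrite -[_ :: _ :: _](cat1s a) -(cat1s x) !rev_cat -catA.
  have -> : rev (a :: [:: x, v, z2 & Z3] ++ [:: w, f & F ++ [:: b, xb & q]]) =
    rev (z2 :: Z3 ++ [:: w, f & F ++ [:: b, xb & q]]) ++ [:: v; x; a].
    by rewrite -[RHS](rev_cat [:: a; x; v]).
  set L := rev (z2 :: _).
  have : last d' L = z2 by rewrite /L rev_cons last_rcons.
  have : 0 < size L by rewrite size_rev.
  case: L => // h r _ /= Lr; symmetry; apply: next_insert; first exact: neq_AW.
  by rewrite Lr; apply: neq_AW.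
(* A second such neighbour would let [connector_bound], applied to the reverse of [c0], give
   [size c0 + 3 <= N], whereas [c0] lacks only [v]. *)
have xpv : excl (prev c) d v.
  move=> d' d'A dd'; rewrite vp //; split=> //; apply/negP => evd'.
  have U0r : uniq (rev c0) by rewrite rev_uniq.
  have cy0r : cycle (@adj G) (rev c0).
    have [p [p' [gp0 ep]]] := cycle_walk (s := c0) isT cy0.
    by apply: (walk_cycle (walk_rev gp0)); rewrite adj_sym.
  have h v' : v' \in rev c0 -> v' \notin H.
    by rewrite mem_rev => h; apply: cH; rewrite (perm_mem pe) inE h orbT.
  have dr : d \in rev c0 by rewrite mem_rev Ac0.
  have d'r : d' \in rev c0 by rewrite mem_rev Ac0.
  have vr : v \notin rev c0 by rewrite mem_rev.
  have /andP [_ vH] : (v \notin A) && (v \notin H) by move: vW; rewrite in_W.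
  have e1 : next (rev c0) d -- v by rewrite pc0 // adj_sym.
  have e2 : v -- next (rev c0) d' by rewrite pc0 // adj_sym.
  rewrite eq_sym in dd'.
  have := connector_bound U0r cy0r h dA d'A dr d'r dd' vr vH e1 e2.
  by move: sc; rewrite (perm_size pe) size_rev; szlia.
pose y := prev c d; pose y' := prev c y.
have yW : y \in W := prev_W g dA.
have y'W : y' \in W := prev2_W g dA.
have ny : next c y = d by rewrite next_prev.
have ny' : next c y' = y by rewrite next_prev.
have nZ z : z \in [:: x, v, z2 & rcons Z3 w] -> next c z \in W.
  have WZ h : h \in [:: x, v, z2 & rcons Z3 w] -> h \in W.
    rewrite -[[:: _, _, _ & _]]/(rcons [:: x, v, z2 & Z3] w) mem_rcons inE.
    by case/orP=> [/eqP ->//|/ZP []].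
  have E2 : c = a :: [:: x, v, z2 & rcons Z3 w] ++ f :: F ++ [:: b, xb & q].
    by rewrite E /= cat_rcons.
  move=> zZ; case/splitPr: zZ E2 WZ => l1 l2 E2 WZ.
  have E4 : c = (a :: l1) ++ z :: l2 ++ f :: F ++ [:: b, xb & q] by rewrite E2 /= -catA.
  rewrite E4; apply: next_in_W => //; first by rewrite -E4.
  by move=> h hl; apply: WZ; rewrite mem_cat inE hl !orbT.
have notZ z : z \in [:: x, v, z2 & rcons Z3 w] -> y == z = false.
  move=> /nZ h; apply/eqP => yz; move: h; rewrite -yz ny.
  by rewrite (negbTE (notin_W dA)).
have vy' : v != y'.
  apply/eqP => vy'; have : y == z2 by rewrite -ny' -vy' nv.
  by rewrite notZ // !inE eqxx !orbT.
have evy' : v -- y' := clique_of (prev_repsys g) dA vW y'W xpv (prev2_excl g dA) vy'.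
have Eb : next c b = xb.
  have E4 : c = [:: a, x, v, z2 & Z3 ++ [:: w, f & F]] ++ [:: b, xb & q] by rewrite E /= -catA.
  by rewrite E4 next_mid // -E4.
(* The induction step for any good cycle in which [v] has left the stretch before [w] and the
   successors of [A] are the same. *)
have fin f' F' q' c' : good c' -> c' = a :: [:: x, z2 & Z3] ++ [:: w, f' & F' ++ [:: b, xb & q']] ->
    f' \in W -> {in A, next c' =1 next c} -> False.
  move=> g' E' f'W nn; apply: (IH c' [:: x, z2 & Z3] f' F' q') => //; first by case: sZ.
  move=> z zZ; have [|zW xz] := ZP z; first by move: zZ; rewrite !inE => /orP [] ->; rewrite ?orbT.
  by split=> //; apply: eq_excl xz => h hA; rewrite nn.
have yc : y \in c by rewrite mem_prev Ac.
(* The successor of [y] is [d] in [A], which rules out the stretch up to [w] and the vertex [xb]. *)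
have : (y \in f :: F) || (y \in q).
  move: yc; rewrite {1}E -[a :: _]/([:: a] ++ [:: x, v, z2 & Z3] ++ _).
  rewrite !mem_cat !inE mem_cat !inE.
  have xbn : y == xb = false.
    apply/eqP => yx; have := next2_W g bA; rewrite Eb -yx ny.
    by rewrite (negbTE (notin_W dA)).
  rewrite xbn !(eq_sym y a) !(eq_sym y b) (negbTE (neq_AW aA yW)) (negbTE (neq_AW bA yW)) /=.
  have nz z : z \in [:: x, v, z2 & rcons Z3 w] -> y == z = false by exact: notZ.
  rewrite (nz x) ?(nz v) ?(nz z2) ?(nz w) ?inE ?mem_rcons ?inE ?eqxx ?orbT //=.
  have -> /= : y \in Z3 = false.
    apply/negP => yZ; have := notZ y; rewrite eqxx !inE mem_rcons inE yZ !orbT.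
    by move=> /(_ isT).
  by rewrite orbA.
rewrite adj_sym in evy'.
case/orP=> [yF|yq].
  have E2 : c = [:: a; x] ++ [:: v, z2 & Z3 ++ w :: (f :: F) ++ [:: b, xb & q]] by rewrite E.
  have : head f (f :: F) = f by [].
  case/splitPr: yF E2 => F1 F2 E2 hf.
  have E3 : c = a :: [:: x] ++ v :: z2 :: (Z3 ++ w :: F1) ++ y :: F2 ++ [:: b, xb & q].
    by rewrite E2 /= -!catA /= -?catA.
  have Ey' : y' = last w F1.
    have -> : last w F1 = last a ([:: x; v; z2] ++ Z3 ++ w :: F1) by rewrite last_cat /= last_cat.
    by apply: prev_last => //; rewrite E3 /= -!catA.
  have g3 := g; rewrite E3 in g3.
  have ey : last z2 (Z3 ++ w :: F1) -- v by rewrite last_cat /= -Ey'.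
  have [g' nn] := relocate g3 exz2 ey evd.
  pose c' := a :: [:: x, z2 & Z3] ++ w :: F1 ++ v :: y :: F2 ++ [:: b, xb & q].
  have Ec' : c' = a :: [:: x] ++ z2 :: (Z3 ++ w :: F1) ++ v :: y :: F2 ++ [:: b, xb & q].
    by rewrite /c' /= -?catA.
  have nn' : {in A, next c' =1 next c}.
    move=> h hA; rewrite Ec' E3 nn //; try exact: neq_AW.
    by rewrite last_cat /= -Ey'; apply: neq_AW.
  rewrite -Ec' in g'.
  (* If [F1] is empty, then [y] is [f], and [v] lands right after [w], taking over the role of
     [f]. *)
  case: F1 hf @c' {E2 E3 g3 nn ey} Ey' Ec' g' nn' => [|f' F1] /= hf Ey' Ec' g' nn'.
    by apply: (fin v (y :: F2) q _ g').
  apply: (fin f (F1 ++ v :: y :: F2) q _ g') => //.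
  by rewrite hf /= -!catA.
case/splitPr: yq E U' g Eb => q1 q2 E U' g0 Eb.
have E3 : c = a :: [:: x] ++ v :: z2 :: (Z3 ++ [:: w, f & F ++ [:: b, xb & q1]]) ++ y :: q2.
  by rewrite E /= -!catA /= -?catA.
have Ey' : y' = last xb q1.
  have -> : last xb q1 = last a ([:: x; v; z2] ++ Z3 ++ [:: w, f & F ++ [:: b, xb & q1]]).
    by rewrite last_cat /= last_cat /= last_cat.
  by apply: prev_last => //; rewrite E3 /= -!catA.
have g3 := g0; rewrite E3 in g3.
have ey : last z2 (Z3 ++ [:: w, f & F ++ [:: b, xb & q1]]) -- v.
  by rewrite last_cat /= last_cat /= -Ey'.
have [g' nn] := relocate g3 exz2 ey evd.
pose c' := a :: [:: x, z2 & Z3] ++ [:: w, f & F ++ [:: b, xb & q1 ++ v :: y :: q2]].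
have Ec' : c' = a :: [:: x] ++ z2 :: (Z3 ++ [:: w, f & F ++ [:: b, xb & q1]]) ++ v :: y :: q2.
  by rewrite /c' /= -!catA /= -?catA.
rewrite -Ec' in g'; apply: (fin f F (q1 ++ v :: y :: q2) c' g') => //.
move=> h hA; rewrite Ec' E3 nn //; try exact: neq_AW.
by rewrite last_cat /= last_cat /= -Ey'; apply: neq_AW.
Qed.

(** * Inner vertices of a segment *)

Lemma traject_next (b : G) l : uniq (b :: l) ->
  l = traject (next (b :: l)) (next (b :: l) b) (size l).
Proof.
move=> U; have := cycle_next U; rewrite /= rcons_path => /andP [/fpathP [n E] _].
by rewrite {1}E; congr traject; rewrite E size_traject.
Qed.

(** Identifies two rotations of [c] with the same first vertex without comparing rotation
    indices. *)
Lemma rot_next_inj c b l l' : uniq (b :: l) -> uniq (b :: l') ->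
  next (b :: l) =1 next c -> next (b :: l') =1 next c -> size l = size l' -> l = l'.
Proof.
move=> U U' e e' sl; rewrite (traject_next U) (traject_next U') sl e e'.
move: (next (b :: l)) (next (b :: l')) e e' => f f' e e'.
by elim: (size l') (next c b) => //= n IH z; rewrite e e' IH.
Qed.

Lemma cat_prefix l1 l2 r (s : G) l3 : l1 ++ l2 = r ++ s :: l3 -> s \notin l1 ->
  exists p, r = l1 ++ p.
Proof.
elim: l1 r => [|x l1 IH] r /=; first by exists r.
case: r => [|y r] /= [<-]; first by move=> _; rewrite inE eqxx.
by move=> /IH h; rewrite inE negb_or => /andP [_ /h [p ->]]; exists p.
Qed.

Lemma split_last_A p : has (mem A) p ->
  exists p1 a p2, [/\ p = p1 ++ a :: p2, a \in A & {in p2, forall v, v \notin A}].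
Proof.
elim: p => //= x p IH; case: (boolP (has (mem A) p)) => [/IH [p1 [a [p2 [-> aA h]]]] _|].
  by exists (x :: p1), a, p2.
by move=> /hasPn h; rewrite orbF => xA; exists [::], x, p.
Qed.

(** Induction along the segment: once the vertices before [v] are exclusive to [a], they serve as
    the [Z] of [no_early_cross] with [v] as its [w]. The vertex [v'] in [W] ensures that [v] is not
    the last of its segment. *)
Lemma inner_excl n c a l1 v v' r : good c -> c = a :: l1 ++ [:: v, v' & r] ->
  size l1 < n -> a \in A -> {in l1, forall z, z \in W} -> v \in W -> v' \in W ->
  excl (next c) a v.
Proof.
elim: n l1 v v' r => // n IH l1 v v' r g E sl aA l1W vW v'W b bA ba.
have [U cy sc Ac cH] := g; have U' := U; rewrite E in U'.
have pv : prev c v = last a l1 by apply: (prev_last U E).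
split.
  apply/eqP => vb; have : prev c v = b by rewrite vb prev_next.
  rewrite pv => lb; have := mem_last a l1; rewrite lb inE (negbTE ba) /= => /l1W.
  by rewrite (negbTE (notin_W bA)).
apply/negP => e.
have br : b \in r.
  have := Ac _ bA; rewrite E !inE mem_cat !inE (negbTE ba).
  rewrite (negbTE (neq_AW bA vW)) (negbTE (neq_AW bA v'W)) /=.
  by case/orP=> // /l1W; rewrite (negbTE (notin_W bA)).
case/splitPr: br {U'} E => F [|xb q] E.
  have := next_W g bA.
  have -> : next c b = a.
    have E4 : c = a :: rcons (l1 ++ [:: v, v' & F]) b by rewrite E -cats1 -catA.
    by rewrite E4 next_end // -E4.
  by rewrite (negbTE (notin_W aA)).
have Eb : next c b = xb.
  have E4 : c = (a :: l1 ++ [:: v, v' & F]) ++ [:: b, xb & q] by rewrite E /= -catA.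
  by rewrite E4 next_mid // -E4.
rewrite Eb in e; apply: (no_early_cross g E erefl aA bA _ vW v'W e) => z zl; split; first exact: l1W.
case/splitPr: zl sl l1W E {pv} => m1 m2 sl l1W E.
have h1 : {in m1, forall y, y \in W} by move=> y ym; apply: l1W; rewrite mem_cat ym.
have zW : z \in W by apply: l1W; rewrite mem_cat inE eqxx orbT.
have h2 : size m1 < n by move: sl; szlia.
case: m2 E l1W {sl} => [|y m2] E l1W.
  by apply: (IH m1 z v _ g _ h2) => //; rewrite E -catA.
apply: (IH m1 z y _ g _ h2) => //; first by rewrite E -catA.
by apply: l1W; rewrite mem_cat !inE eqxx !orbT.
Qed.

(** * Segments of the cycle between vertices of A *)

Section Segments.
Variable c : seq G.
Hypothesis g : good c.

(* [seg a] lists the vertices strictly between [a] and the next vertex [succA a]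
   of [A] along [c]. *)
Definition after a := behead (rot (index a c) c).
Definition seg a := take (find (mem A) (after a)) (after a).
Definition succA a := nth a (after a) (find (mem A) (after a)).
Definition segX a := next c a.
Definition segY a := last a (seg a).

Let Uc : uniq c. Proof. by case: g. Qed.
Let Ac : {subset A <= c}. Proof. by case: g. Qed.

Lemma rot_after a : a \in A -> rot (index a c) c = a :: after a.
Proof. by move=> aA; rewrite /after rot_index ?Ac. Qed.

Lemma after_has a : a \in A -> has (mem A) (after a).
Proof.
move=> aA; have [b bA ba] : exists2 b, b \in A & b != a.
  have : 0 < #|A :\ a| by move: A3; rewrite (cardsD1 a) aA; lia.
  by case/card_gt0P => b; rewrite !inE => /andP [ba bA]; exists b.
apply/hasP; exists b => //; have := Ac bA.
by rewrite -(mem_rot (index a c) c) rot_after // inE (negbTE ba).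
Qed.

Lemma seg_W a v : a \in A -> v \in seg a -> v \in W.
Proof.
move=> aA vs; have [_ _ _ _ cH] := g.
rewrite in_W cH ?andbT; last first.
  by rewrite -(mem_rot (index a c) c) rot_after // inE (mem_take vs) orbT.
apply/negP => vA; have := vs; rewrite /seg => /(nthP a) [i].
rewrite size_take; have := after_has aA; rewrite has_find => -> lti.
rewrite nth_take // => Ev; have := before_find a lti.
by rewrite Ev /= vA.
Qed.

Lemma succA_in a : a \in A -> succA a \in A.
Proof. by move=> aA; apply: (nth_find a (after_has aA)). Qed.

Lemma seg_split a : a \in A -> exists r, rot (index a c) c = a :: seg a ++ succA a :: r.
Proof.
move=> aA; exists (drop (find (mem A) (after a)).+1 (after a)).
rewrite rot_after // /seg /succA -drop_nth ?cat_take_drop //.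
by rewrite -has_find after_has.
Qed.

Lemma succA_neq a : a \in A -> succA a != a.
Proof.
move=> aA; have [r E] := seg_split aA; apply/eqP => E1.
have : uniq (rot (index a c) c) by rewrite rot_uniq.
by rewrite E E1 /= mem_cat inE eqxx orbT.
Qed.

Lemma seg_cat a l : a \in A -> uniq (a :: l) -> next (a :: l) =1 next c ->
  size l = (size c).-1 -> exists r, l = seg a ++ succA a :: r.
Proof.
move=> aA U e sl; have [r E] := seg_split aA; exists r.
apply: (@rot_next_inj c a) => //.
- by rewrite -E rot_uniq.
- by move=> v; rewrite -E next_rotE.
by move/(congr1 size): E; rewrite size_rot sl => -> .
Qed.

Lemma seg_cover v : v \in W -> exists2 a, a \in A & v \in seg a.
Proof.
move=> vW; have vH : v \notin H by move: vW; rewrite in_W => /andP [].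
have [i p E] := rot_to (mem_good g vH).
have [a0 a0A] : exists a, a \in A by apply/card_gt0P; move: A3; lia.
have hp : has (mem A) p.
  apply/hasP; exists a0 => //; have := Ac a0A.
  by rewrite -(mem_rot i c) E inE (negbTE (neq_AW a0A vW)).
have [p1 [a [p2 [Ep aA h]]]] := split_last_A hp.
exists a => //.
have E2 : rot (size (v :: p1)) (rot i c) = a :: p2 ++ v :: p1.
  by rewrite E Ep -cat_cons rot_size_cat.
have [||| r Er] := @seg_cat a (p2 ++ v :: p1) aA.
- by rewrite -E2 !rot_uniq.
- by move=> z; rewrite -E2 !next_rotE ?rot_uniq.
- by move/(congr1 size): E2; rewrite !size_rot => ->.
have : rcons p2 v ++ p1 = seg a ++ succA a :: r by rewrite cat_rcons.
move=> /cat_prefix []; last by move=> q ->; rewrite mem_cat mem_rcons inE eqxx.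
rewrite mem_rcons inE negb_or (neq_AW (succA_in aA) vW) /=.
by apply/negP => /h; rewrite succA_in.
Qed.

Lemma segE a : a \in A -> exists Q', seg a = [:: segX a, next c (segX a) & Q'].
Proof.
move=> aA; have [r E] := seg_split aA.
have U : uniq (rot (index a c) c) by rewrite rot_uniq.
have e z : next (rot (index a c) c) z = next c z by rewrite next_rotE.
rewrite /segX; move: (next_W g aA) (next2_W g aA); rewrite -!e E.
rewrite E in U.
case: (seg a) U => [|x [|y Q']] U.
- by rewrite (@next_mid _ [::] a (succA a)) // (negbTE (notin_W (succA_in aA))).
- rewrite (@next_mid _ [::] a x) // (@next_mid _ [:: a] x (succA a)) //.
  by rewrite (negbTE (notin_W (succA_in aA))).
rewrite (@next_mid _ [::] a x) // (@next_mid _ [:: a] x y) //.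
by exists Q'.
Qed.

Lemma segY_in a : a \in A -> segY a \in seg a.
Proof. by move=> /segE [Q' E]; rewrite /segY E /= in_cons mem_last orbT. Qed.

Lemma segX_in a : a \in A -> segX a \in seg a.
Proof. by move=> /segE [Q' ->]; rewrite inE eqxx. Qed.

Lemma segX2_in a : a \in A -> next c (segX a) \in seg a.
Proof. by move=> /segE [Q' ->]; rewrite !inE eqxx orbT. Qed.

Lemma prev_succA a : a \in A -> prev c (succA a) = segY a.
Proof.
move=> aA; have [r E] := seg_split aA.
rewrite -(prev_rot (index a c) Uc).
by apply: prev_last; rewrite ?rot_uniq ?E.
Qed.

Lemma seg_uniq a : a \in A -> uniq (seg a).
Proof.
move=> aA; have [r E] := seg_split aA.
have : uniq (rot (index a c) c) by rewrite rot_uniq.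
by rewrite E /= cat_uniq => /and3P [_ ->].
Qed.

Lemma seg_walk a : a \in A -> [/\ walk (segX a) (seg a) (segY a), a -- segX a & segY a -- succA a].
Proof.
move=> aA; have [r E] := seg_split aA; have [_ cy _ _ _] := g.
have [Q' EQ] := segE aA.
have := cy; rewrite -(rot_cycle (index a c)) E EQ /= rcons_cat cat_path /=.
rewrite /segY EQ => /and5P [e1 e2 p e3 _]; split=> //.
by rewrite /= !eqxx e2 p.
Qed.

(** The four arcs from which reroutings between two segments are assembled. The last clause detaches
    [succA a] from [P1], for [chord_far], where that vertex is visited separately. *)
Lemma two_segs a b : a \in A -> b \in A -> a != b ->
  exists P1 P2, [/\ walk (succA a) P1 b, walk (succA b) P2 a,
    perm_eq (seg a ++ P1 ++ seg b ++ P2) c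
    & succA a != b -> exists2 P, P1 = succA a :: P & walk (segX (succA a)) P b].
Proof.
move=> aA bA ab; have [r E] := seg_split aA; have [_ cy sc _ _] := g.
have br : b \in succA a :: r.
  have := Ac bA; rewrite -(mem_rot (index a c) c) E inE eq_sym (negbTE ab) mem_cat /=.
  by case/orP=> // /(seg_W aA); rewrite (negbTE (notin_W bA)).
have [p1 [r2 E1]] : exists p1 r2, succA a :: r = p1 ++ b :: r2.
  by case/splitPr: br => p1 r2; exists p1, r2.
have E2 : rot (size (a :: seg a ++ p1)) (rot (index a c) c) = b :: r2 ++ a :: seg a ++ p1.
  by rewrite E E1 catA -cat_cons rot_size_cat.
have [||| r3 E3] := @seg_cat b (r2 ++ a :: seg a ++ p1) bA.
- by rewrite -E2 !rot_uniq.
- by move=> z; rewrite -E2 !next_rotE ?rot_uniq.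
- by move/(congr1 size): E2; rewrite !size_rot => ->.
have [p2 E4] : exists p2, r2 = seg b ++ p2.
  apply: (@cat_prefix (seg b) (succA b :: r3) r2 a (seg a ++ p1)); first by rewrite E3.
  by apply/negP => /(seg_W bA); rewrite (negbTE (notin_W aA)).
exists (rcons p1 b), (rcons p2 a).
have pe : perm_eq (seg a ++ rcons p1 b ++ seg b ++ rcons p2 a) c.
  rewrite perm_sym -(perm_rot (index a c)) E E1 E4; apply/permP => f; rewrite -!cats1; cntlia.
have h1 : exists q1, rcons p1 b = succA a :: q1.
  by case: (p1) E1 => [|z l] [-> _]; [exists [::] | exists (rcons l b)].
have h2 : exists q2, rcons p2 a = succA b :: q2.
  move: E3; rewrite E4 -catA => /(congr1 (drop (size (seg b)))).
  rewrite !drop_size_cat //.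
  by case: (p2) => [|z l] [-> _]; [exists [::] | exists (rcons l a)].
have [q1 h1'] := h1; have [q2 h2'] := h2.
have E5 : rot 1 (rot (index a c) c) = seg a ++ rcons p1 b ++ seg b ++ rcons p2 a.
  by rewrite E E1 E4 rot1_cons -!cats1 -!catA /= -!catA.
have : cycle (@adj G) (seg a ++ rcons p1 b ++ seg b ++ rcons p2 a) by rewrite -E5 !rot_cycle.
have s0 d : d \in A -> seg d != [::] by move=> /segE [? ->].
have r0 l z l' : rcons l z ++ l' != [::] by case: l.
have r1 l z : rcons l z != [::] by case: l.
case/(cycle_split (s0 _ aA) (r0 _ _ _)) => x1 [y1 [x2 [y2 [_ _ + _]]]].
have s1 l : seg b ++ l != [::] by have [? ->] := segE bA.
case/(walk_split (r1 _ _) (s1 _)) => x3 [y3 [g1 _ /(walk_split (s0 _ bA) (r1 _ _)) [? [x4 [_ _ g2]]]]].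
have f1 := walk_last g1; have f2 := walk_last g2.
have f3 : x2 = succA a by move: g1; rewrite h1' => /walk_head.
have f4 : x4 = succA b by move: g2; rewrite h2' => /walk_head.
subst; split=> // sb.
case: q1 h1' => [|x q1] h1'.
  have gb : walk (succA a) [:: succA a] b by rewrite -h1'.
  have bs : b = succA a := @walk_last _ _ _ [::] _ gb.
  by rewrite -bs eqxx in sb.
exists (x :: q1) => //; suff -> : segX (succA a) = x by move: g1; rewrite h1' => /walk_tail [].
have := E5; rewrite h1' /= => E6.
have nn : next (rot 1 (rot (index a c) c)) (succA a) = next c (succA a).
  by rewrite !next_rotE ?rot_uniq.
rewrite /segX -nn E6.
by apply: next_mid; rewrite -E6 !rot_uniq.
Qed.

Lemma seg_disj a b v : a \in A -> b \in A -> v \in seg a -> v \in seg b -> a = b.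
Proof.
move=> aA bA va vb; apply/eqP/negPn/negP => ab.
have [P1 [P2 [_ _ pe _]]] := two_segs aA bA ab.
have := Uc; rewrite -(perm_uniq pe) cat_uniq => /and3P [_ /hasPn /(_ v) + _].
by rewrite !mem_cat vb !orbT /= va => /(_ isT).
Qed.

Lemma succA_inj a b : a \in A -> b \in A -> succA a = succA b -> a = b.
Proof.
move=> aA bA e; apply: (seg_disj aA bA (segY_in aA)).
by rewrite -(prev_succA aA) e (prev_succA bA) segY_in.
Qed.

Lemma segX_neq_segY a : a \in A -> segX a != segY a.
Proof.
move=> aA; have := seg_uniq aA; have [Q' E] := segE aA.
rewrite /segY E /= => /andP [h _]; apply/eqP => e; move: h; rewrite {1}e.
by rewrite mem_last.
Qed.

Lemma segX_far a b v : a \in A -> b \in A -> a != b -> v \in seg a -> v != segY a ->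
  ~~ segX b -- v.
Proof.
move=> aA bA ab vs vY; have [r E] := seg_split aA.
have [l1 [v' [l2 Es]]] : exists l1 v' l2, seg a = l1 ++ [:: v, v' & l2].
  move: vY; rewrite /segY; case/splitPr: vs => l1 [|v' l2]; last by exists l1, v', l2.
  by rewrite last_cat /= eqxx.
have E' : rot (index a c) c = a :: l1 ++ [:: v, v' & l2 ++ succA a :: r] by rewrite E Es -catA.
have W' z : z \in seg a -> z \in W by exact: seg_W.
rewrite eq_sym in ab.
have [] := inner_excl (good_rot _ g) E' (ltnSn _) aA _ _ _ bA ab.
- by move=> z zl; apply: W'; rewrite Es mem_cat zl.
- by apply: W'; rewrite Es mem_cat inE eqxx orbT.
- by apply: W'; rewrite Es mem_cat !inE eqxx !orbT.
by rewrite next_rotE.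
Qed.

Lemma segY_excl a v : a \in A -> v \in seg a -> v != segX a -> excl (prev c) (succA a) v.
Proof.
move=> aA vs vX; have [r E] := seg_split aA.
have [l1 [v' [l2 Es]]] : exists l1 v' l2, seg a = l2 ++ [:: v', v & l1].
  have [Q' EQ] := segE aA; move: vs; rewrite {1}EQ inE (negbTE vX) /= => vQ.
  have : seg a = segX a :: next c (segX a) :: Q' by [].
  case/splitPr: vQ => m1 m2 ->; rewrite -cat_cons lastI.
  by exists m2, (last (segX a) m1), (belast (segX a) m1); rewrite cat_rcons.
(* The reversed cycle started at [succA a], so that [seg a] comes first, read backwards. *)
have E' : rot (size r) (rev (rot (index a c) c)) = succA a :: rev l1 ++ [:: v, v' & rev l2 ++ a :: rev r].
  rewrite E rev_cons rev_cat rev_cons -!cats1 -!catA /= -(size_rev r) rot_size_cat.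
  by rewrite Es rev_cat !rev_cons -!cats1 /= -!catA.
have W' z : z \in seg a -> z \in W by exact: seg_W.
have g' : good (rot (size r) (rev (rot (index a c) c))).
  by apply: good_rot; apply: good_rev; apply: good_rot.
apply: (@eq_excl (next (rot (size r) (rev (rot (index a c) c))))).
  move=> d dA; rewrite next_rotE ?rev_uniq ?rot_uniq // next_rev ?rot_uniq //.
  by rewrite prev_rot.
apply: (inner_excl g' E' (ltnSn _) (succA_in aA)).
- by move=> z; rewrite mem_rev => zl; apply: W'; rewrite Es mem_cat !inE zl !orbT.
- by apply: W'; rewrite Es mem_cat !inE eqxx !orbT.
- by apply: W'; rewrite Es mem_cat !inE eqxx !orbT.
Qed.

Lemma segX_excl a v : a \in A -> v \in seg a -> v != segY a -> excl (next c) a v.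
Proof.
move=> aA vs vY b bA ba; split; last by apply: segX_far vY => //; rewrite eq_sym.
apply/eqP => vb; move: vs; rewrite vb => h; have := seg_disj aA bA h (segX_in bA).
by move=> ab; rewrite ab eqxx in ba.
Qed.

Lemma segY_far a b v : a \in A -> b \in A -> a != b -> v \in seg a -> v != segX a ->
  ~~ segY b -- v.
Proof.
move=> aA bA ab vs vX; rewrite -(prev_succA bA).
have [] // := segY_excl aA vs vX (succA_in bA).
by apply: contra ab => /eqP /(succA_inj bA aA) ->.
Qed.

(* Otherwise [segY a], the vertices [segX b] missing it and the vertices
   [next c (segX b)] for the [segX b] seeing it would be too many independent vertices. *)
Lemma segX_adj_segY a : a \in A -> segX a -- segY a.
Proof.
move=> aA; apply/negPn/negP => nXY.
have [_ cy sc _ cH] := g; have [r E] := seg_split aA.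
have YW := seg_W aA (segY_in aA).
pose f b := if segX b -- segY a then next c (segX b) else segX b.
have fs b : b \in A -> f b \in seg b.
  by move=> bA; rewrite /f; case: ifP => _; rewrite ?segX2_in ?segX_in.
have E2 : rot (size (a :: seg a)) (rot (index a c) c) = succA a :: r ++ a :: seg a.
  by rewrite E -cat_cons rot_size_cat.
have cy2 : cycle (@adj G) (succA a :: r ++ a :: seg a) by rewrite -E2 !rot_cycle.
have U2 : uniq (succA a :: r ++ a :: seg a) by rewrite -E2 !rot_uniq.
have n2 z : next (succA a :: r ++ a :: seg a) z = next c z by rewrite -E2 !next_rotE ?rot_uniq.
have m2 z : z \in succA a :: r ++ a :: seg a = (z \in c) by rewrite -E2 !mem_rot.
have gl : walk (succA a) (succA a :: r ++ a :: seg a) (segY a).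
  have -> : segY a = last (succA a) (r ++ a :: seg a) by rewrite last_cat.
  by apply: walk_path; move: cy2; rewrite /= rcons_path => /andP [].
have [_ _ eYs] := seg_walk aA.
have pl : perm_eq (succA a :: r ++ a :: seg a) c by rewrite -E2 !perm_rot.
(* With the cycle opened after [segY a] and [m] before [m']: from [next c (segX m')] on to [segY a],
   over [segX m] and [m] back to [succA a], through [H] to [m'], then back to [next c (segX m)].
   Only [segX m'] is dropped. *)
have key m m' : m \in A -> m' \in A -> m != m' -> segX m -- segY a -> segX m' -- segY a ->
    ~~ next c (segX m) -- next c (segX m').
  move=> mA m'A mm' e1 e2; apply/negP => ee.
  have := split2 (l := succA a :: r ++ a :: seg a) (x := m) (y := m').
  rewrite !m2 !Ac // => /(_ isT isT mm') [l1 [l2 [l3 El]]].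
  wlog El' : m m' mA m'A mm' e1 e2 ee El / succA a :: r ++ a :: seg a = l1 ++ m :: l2 ++ m' :: l3.
    move=> hw; case: El => El; first by apply: (hw m m') => //; left.
    by apply: (hw m' m) => //; first [rewrite eq_sym | rewrite adj_sym | left].
  have nW z : z \in W -> m' != z by move=> zW; apply: neq_AW.
  rewrite El' in n2 U2 gl pl.
  have [L2 EL2] : exists L2, l2 = [:: segX m, next c (segX m) & L2].
    case: l2 El El' n2 U2 gl pl => [|x [|y L2]] El El' n2 U2 gl pl.
    - by have := n2 m; rewrite next_mid // => Em; have := nW _ (next_W g mA); rewrite -Em eqxx.
    - have := n2 m; rewrite (@next_mid _ l1 m x) // => Em.
      have := n2 x; have := @next_mid _ (rcons l1 m) x m' l3.
      rewrite cat_rcons => -> // Ex; have := nW _ (next2_W g mA).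
      by rewrite -Em -Ex eqxx.
    have := n2 m; rewrite (@next_mid _ l1 m x) // => Em.
    have := n2 x; have := @next_mid _ (rcons l1 m) x y (L2 ++ m' :: l3).
    by rewrite cat_rcons => -> // Ex; exists L2; rewrite /segX -Em -Ex.
  have am' : a != m' by apply/eqP => am'; move: nXY; rewrite {1}am' e2.
  have lY : last (succA a) (r ++ a :: seg a) = segY a by rewrite last_cat.
  have [L3 EL3] : exists L3, l3 = [:: segX m', next c (segX m') & L3].
    have lY' : last m' l3 = segY a.
      by have := congr1 (last a) El'; rewrite /= lY !last_cat /= last_cat.
    have E3 : l1 ++ m :: l2 ++ m' :: l3 = (l1 ++ m :: l2) ++ m' :: l3 by rewrite -catA.
    rewrite E3 in n2 U2.
    case: l3 El El' n2 U2 gl lY' pl E3 => [|x [|y L3]] El El' n2 U2 gl lY' pl E3.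
    - by have := nW _ YW; rewrite -lY' /= eqxx.
    - have := n2 m'; rewrite (@next_mid _ _ m' x) //= => Em.
      have h := segY_in aA; rewrite -lY' /= Em in h.
      by have := seg_disj aA m'A h (segX_in m'A) => amm; rewrite amm eqxx in am'.
    have := n2 m'; rewrite (@next_mid _ _ m' x) // => Em.
    have := n2 x; have := @next_mid _ (rcons (l1 ++ m :: l2) m') x y L3.
    by rewrite cat_rcons => -> // Ex; exists L3; rewrite /segX -Em -Ex.
  have sm' : succA a != m'.
    have hd : head a (l1 ++ m :: l2 ++ m' :: l3) = succA a by rewrite -El'.
    apply/eqP => sm; move: U2 hd; rewrite sm; case: (l1) => [|z l1'] /= U2 hd.
      by rewrite hd eqxx in mm'.
    by move: U2; rewrite hd !mem_cat !inE !mem_cat !inE eqxx !orbT.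
  have [x0 [s [y0 [gs e3 e4 ss [us sH]]]]] := link (succA_in aA) m'A sm'.
  have UU := link_uniq Uc cH us sH.
  move: gl pl; rewrite EL2 EL3.
  rewrite -cat_rcons => gl pl.
  have r0 (l : seq G) z : rcons l z != [::] by case: l.
  have [m0 [g1 e5 /walk_tail [_ gl2]]] := walk_split_cons (r0 _ _) gl.
  have [z2 [g2 e6 /walk_tail [_ /walk_tail [_ g3]]]] := @walk_split_cons _ _ (_ :: L2) _ _ _ isT gl2.
  have Em0 := walk_last g1; subst m0.
  rewrite adj_sym in e1; rewrite adj_sym in e5; rewrite adj_sym in e6.
  apply: (too_long (walk_cat g3 e1 (walk_cat (walk1 (segX m)) e5 (walk_cat (walk_rev g1) e3
    (walk_cat gs e4 (walk_cat (walk1 m') e6 (walk_rev g2)))))) ee).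
    apply/uniq_countP => z; move/uniq_countP: UU => /(_ z); move: (permP pl (pred1 z)).
    by rewrite -!cats1; cntlia.
  by move: ss sc (perm_size pl); szlia.
have rs : rep_system f.
  have [h1 h2] := next_repsys g.
  split=> [b bA|b b' bA b'A bb']; first exact: seg_W (fs _ bA).
  split.
    apply/eqP => eb; have := fs b bA; rewrite eb => h; have := seg_disj bA b'A h (fs _ b'A).
    by move=> e; rewrite e eqxx in bb'.
  rewrite /f; case: ifP => e; case: ifP => e'.
  - exact: key.
  - by rewrite adj_sym; apply: next2_indep.
  - by apply: next2_indep => //; rewrite eq_sym.
  by have [] := h2 _ _ bA b'A bb'.
have [b bA] := dom rs YW.
have -> /= : segY a == f b = false.
  apply/eqP => e; have h := segY_in aA; rewrite e in h.
  have ab := seg_disj aA bA h (fs _ bA); move: e; rewrite /f -ab (negbTE nXY).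
  by move=> e; have := segX_neq_segY aA; rewrite e eqxx.
rewrite /f; case: ifP => e; last by rewrite adj_sym e.
apply/negP; apply: segY_far (segX2_in bA) _ => //.
  by apply/eqP => ba; rewrite ba (negbTE nXY) in e.
by rewrite eq_sym; apply: adj_neq; apply: next_cycle => //; rewrite /segX mem_next Ac.
Qed.

(** All vertices but [segY a] are exclusive to [a] for successors, all but [segX a] are exclusive to
    [succA a] for predecessors. [clique_of] settles both sets, and only the pair of ends remains. *)
Lemma seg_clique a : a \in A -> {in seg a &, forall u v, u != v -> u -- v}.
Proof.
move=> aA u v us vs uv.
case: (altP (u =P segY a)) => [uY|uY]; case: (altP (v =P segY a)) => [vY|vY].
- by rewrite uY vY eqxx in uv.
- case: (altP (v =P segX a)) => [->|vX]; first by rewrite uY adj_sym segX_adj_segY.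
  apply: (clique_of (prev_repsys g) (succA_in aA) (seg_W aA us) (seg_W aA vs) _ (segY_excl aA vs vX)) => //.
  by apply: segY_excl => //; rewrite uY eq_sym segX_neq_segY.
- case: (altP (u =P segX a)) => [->|uX]; first by rewrite vY segX_adj_segY.
  apply: (clique_of (prev_repsys g) (succA_in aA) (seg_W aA us) (seg_W aA vs) (segY_excl aA us uX)) => //.
  by apply: segY_excl => //; rewrite vY eq_sym segX_neq_segY.
exact: (clique_of (next_repsys g) aA (seg_W aA us) (seg_W aA vs) (segX_excl aA us uY) (segX_excl aA vs vY)).
Qed.

Lemma seg_traverse a u v : a \in A -> u \in seg a -> v \in seg a -> u != v ->
  exists2 r, perm_eq r (seg a) & walk u r v.
Proof.
by move=> aA us vs uv; apply: clique_walk => //; [apply: seg_clique | apply: seg_uniq].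
Qed.

(** * Edges between two segments *)

Let cH : {in c, forall v, v \notin H}. Proof. by case: g. Qed.
Let sc : size c = N. Proof. by case: g. Qed.

Ltac closing UU pe ss :=
  lazymatch goal with
  | |- is_true (uniq _) => apply/uniq_countP; let z := fresh "z" in intro z;
     generalize (elimT (uniq_countP _) UU z) (permP pe (pred1 z));
     rewrite -?cats1; cntlia
  | _ => generalize ss sc (perm_size pe); szlia end.

Section Pair.
Variables a b : G.
Hypotheses (aA : a \in A) (bA : b \in A) (ab : a != b).

Lemma succA_neq2 : succA a != succA b.
Proof. by apply: contra ab => /eqP /(succA_inj aA bA) ->. Qed.

(** Cliques can be traversed between any two vertices: [seg a] from [segY a] to [q] and [seg b] from
    [q'] to [segY b]. So crossing by [q -- q'] and linking [a] to [b] in [H] loses nothing. *)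
Lemma cross_notY (q q' : G) : q \in seg a -> q != segY a -> q' \in seg b -> q' != segY b -> ~~ q -- q'.
Proof.
move=> qs qY q's q'Y; apply/negP => e.
have [P1 [P2 [g1 g2 pe _]]] := two_segs aA bA ab.
have [x [s [y [gs e1 e2 ss [us sH]]]]] := link aA bA ab.
have UU := link_uniq Uc cH us sH.
have [_ _ ea] := seg_walk aA; have [_ _ eb] := seg_walk bA.
rewrite eq_sym in qY.
have [ra pra ga] := seg_traverse aA (segY_in aA) qs qY.
have [rb prb gb] := seg_traverse bA q's (segY_in bA) q'Y.
have {}pe : perm_eq (ra ++ P1 ++ rb ++ P2) c.
  by apply: perm_trans pe; rewrite perm_cat // perm_cat2l perm_cat2r.
rewrite adj_sym in ea.
apply: (too_long (walk_cat g2 e1 (walk_cat gs e2 (walk_cat (walk_rev g1) ea (walk_cat ga e gb)))) eb);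
closing UU pe ss.
Qed.

(** The mirror image, with [H] linking [succA a] to [succA b]. *)
Lemma cross_notX (q q' : G) : q \in seg a -> q != segX a -> q' \in seg b -> q' != segX b -> ~~ q -- q'.
Proof.
move=> qs qX q's q'X; apply/negP => e.
have [P1 [P2 [g1 g2 pe _]]] := two_segs aA bA ab.
have [x [s [y [gs e1 e2 ss [us sH]]]]] := link (succA_in aA) (succA_in bA) succA_neq2.
have UU := link_uniq Uc cH us sH.
have [_ ea _] := seg_walk aA; have [_ eb _] := seg_walk bA.
rewrite eq_sym in qX.
have [ra pra ga] := seg_traverse aA (segX_in aA) qs qX.
have [rb prb gb] := seg_traverse bA q's (segX_in bA) q'X.
have {}pe : perm_eq (ra ++ P1 ++ rb ++ P2) c.
  by apply: perm_trans pe; rewrite perm_cat // perm_cat2l perm_cat2r.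
rewrite adj_sym in eb.
apply: (too_long (walk_cat g2 ea (walk_cat ga e (walk_cat gb eb (walk_cat (walk_rev g1) e1 gs)))) e2);
closing UU pe ss.
Qed.

Lemma cross_chord (q q' : G) : q \in seg a -> q' \in seg b -> q -- q' ->
  (q = segY a /\ q' = segX b) \/ (q = segX a /\ q' = segY b).
Proof.
move=> qs q's e.
case: (altP (q =P segY a)) => [qY|qY].
  have qX : q != segX a by rewrite qY eq_sym segX_neq_segY.
  case: (altP (q' =P segX b)) => [q'X|q'X]; first by left.
  by have := cross_notX qs qX q's q'X; rewrite e.
case: (altP (q' =P segY b)) => [q'Y|q'Y]; last by have := cross_notY qs qY q's q'Y; rewrite e.
have q'X : q' != segX b by rewrite q'Y eq_sym segX_neq_segY.
case: (altP (q =P segX a)) => [qX|qX]; first by right.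
by have := cross_notX qs qX q's q'X; rewrite e.
Qed.

Hypothesis chord : segY a -- segX b.

(** The chord leads from [seg a] straight into [seg b], so [seg a] can be entered at [z], coming
    from [H] through [b] and [P1] backwards. *)
Lemma chord_succA_left z : z \in seg a -> z != segY a -> ~~ z -- succA a.
Proof.
move=> zs zY; apply/negP => e.
have [P1 [P2 [g1 g2 pe _]]] := two_segs aA bA ab.
have [x [s [y [gs e1 e2 ss [us sH]]]]] := link aA bA ab.
have UU := link_uniq Uc cH us sH.
have [gb _ eb] := seg_walk bA.
have [ra pra ga] := seg_traverse aA zs (segY_in aA) zY.
have {}pe : perm_eq (ra ++ P1 ++ seg b ++ P2) c.
  by apply: perm_trans pe; rewrite perm_cat2r.
rewrite adj_sym in e.
apply: (too_long (walk_cat g2 e1 (walk_cat gs e2 (walk_cat (walk_rev g1) e (walk_cat ga chord gb)))) eb);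
closing UU pe ss.
Qed.

(** Here [H] links [a] to [succA a], and [P1] is walked forwards to [b] and then [z]. *)
Lemma chord_left z : z \in seg a -> z != segY a -> ~~ z -- b.
Proof.
move=> zs zY; apply/negP => e.
have [P1 [P2 [g1 g2 pe _]]] := two_segs aA bA ab.
have h := succA_neq aA; rewrite eq_sym in h.
have [x [s [y [gs e1 e2 ss [us sH]]]]] := link aA (succA_in aA) h.
have UU := link_uniq Uc cH us sH.
have [gb _ eb] := seg_walk bA.
have [ra pra ga] := seg_traverse aA zs (segY_in aA) zY.
have {}pe : perm_eq (ra ++ P1 ++ seg b ++ P2) c.
  by apply: perm_trans pe; rewrite perm_cat2r.
rewrite adj_sym in e.
apply: (too_long (walk_cat g2 e1 (walk_cat gs e2 (walk_cat g1 e (walk_cat ga chord gb)))) eb);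
closing UU pe ss.
Qed.

(** After the chord, [seg b] is left at [z] for [b], then [P1] backwards and [H] lead to
    [succA b]. *)
Lemma chord_right z : z \in seg b -> z != segX b -> ~~ z -- b.
Proof.
move=> zs zX; apply/negP => e.
have [P1 [P2 [g1 g2 pe _]]] := two_segs aA bA ab.
have [x [s [y [gs e1 e2 ss [us sH]]]]] := link (succA_in aA) (succA_in bA) succA_neq2.
have UU := link_uniq Uc cH us sH.
have [ga ea _] := seg_walk aA.
rewrite eq_sym in zX.
have [rb prb gb] := seg_traverse bA (segX_in bA) zs zX.
have {}pe : perm_eq (seg a ++ P1 ++ rb ++ P2) c.
  by apply: perm_trans pe; rewrite !perm_cat2l perm_cat2r.
apply: (too_long (walk_cat g2 ea (walk_cat ga chord (walk_cat gb e (walk_cat (walk_rev g1) e1 gs)))) e2);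
closing UU pe ss.
Qed.

End Pair.

(** The chord bypasses just [succA a], which can then be visited elsewhere, between [q] and [H]:
    after [q] if [q] is the last vertex of its segment, before it otherwise. *)
Lemma chord_far a j (q : G) : a \in A -> j \in A -> j != a -> j != succA a -> segY a -- segX (succA a) ->
  q \in seg j -> ~~ q -- succA a.
Proof.
move=> aA jA ja jsg chord qs; apply/negP => e.
rewrite eq_sym in ja; have [P1 [P2 [g1 g2 pe]]] := two_segs aA jA ja.
have jsg' : succA a != j by rewrite eq_sym.
move=> /(_ jsg') [P EP gP].
have [ga ea _] := seg_walk aA; have [gj ej ej'] := seg_walk jA.
rewrite EP in pe.
case: (altP (q =P segY j)) => [qY|qY].
  have [x [s [y [gs e1 e2 ss [us sH]]]]] := link (succA_in aA) (succA_in jA) (succA_neq2 aA jA ja).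
  have UU := link_uniq Uc cH us sH; rewrite qY in e.
  apply: (too_long (walk_cat g2 ea (walk_cat ga chord (walk_cat gP ej (walk_cat gj e
    (walk_cat (walk1 (succA a)) e1 gs))))) e2); closing UU pe ss.
have [x [s [y [gs e1 e2 ss [us sH]]]]] := link jA (succA_in aA) jsg.
have UU := link_uniq Uc cH us sH.
have [rj prj gj'] := seg_traverse jA qs (segY_in jA) qY.
have {}pe : perm_eq (seg a ++ (succA a :: P) ++ rj ++ P2) c.
  by apply: perm_trans pe; rewrite !perm_cat2l perm_cat2r.
rewrite adj_sym in e.
apply: (too_long (walk_cat g2 ea (walk_cat ga chord (walk_cat gP e1 (walk_cat gs e2
  (walk_cat (walk1 (succA a)) e gj'))))) ej'); closing UU pe ss.
Qed.

(** * Counting the neighbours of a segment *)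

Definition chordY a := [exists b in A, (b != a) && segY a -- segX b].
Definition chordX a := [exists b in A, (b != a) && segY b -- segX a].

(* [E] collects the chord ends of the segment, so the rest of the segment has all its
   neighbours in [E] and in [A] minus [B]. *)
Lemma seg_count a (E B : {set G}) (z : G) : a \in A -> E \subset [set segX a; segY a] ->
  (chordX a -> segX a \in E) -> (chordY a -> segY a \in E) -> B \subset A ->
  z \in seg a -> z \notin E ->
  (forall v b, v \in seg a -> v \notin E -> b \in B -> ~~ v -- b) -> #|B| <= #|E|.
Proof.
move=> aA EX hX hY BA zs zE nB.
pose S := [set v in seg a] :\: E.
have SW : S \subset W by apply/subsetP => v; rewrite !inE => /andP [_ vs]; have := seg_W aA vs; rewrite !inE.
have S0 : S != set0 by apply/set0Pn; exists z; rewrite !inE zs zE.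
have := conn SW S0; set NS := [set _ | _] => le.
have : NS \subset (A :\: B) :|: E.
  apply/subsetP => v; rewrite inE => /andP [vS /existsP [s /andP [sS e]]].
  have [sE ss] : s \notin E /\ s \in seg a by move: sS; rewrite !inE => /andP.
  have sW := seg_W aA ss; rewrite !inE.
  case: (boolP (v \in A)) => vA.
    rewrite andbT; apply/orP; left; apply/negP => vB.
    by have := nB _ _ ss sE vB; rewrite e.
  have vH : v \notin H.
    apply/negP => vH; have := nbrH vH e; move: sW; rewrite in_W !inE.
    by case/andP=> /negbTE -> /negbTE ->.
  have vW : v \in W by rewrite in_W vA vH.
  have [d dA vd] := seg_cover vW; rewrite andbF /=.
  case: (altP (a =P d)) => [ad|ad].
    by move: vS; rewrite !inE ad vd andbT negbK.
  have da : d != a by rewrite eq_sym.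
  case: (cross_chord aA dA ad ss vd e) => [[sY vX]|[sX vY]].
    have /hY : chordY a by apply/existsP; exists d; rewrite dA da -sY -vX e.
    by rewrite -sY (negbTE sE).
  have /hX : chordX a by apply/existsP; exists d; rewrite dA da -sX -vY adj_sym e.
  by rewrite -sX (negbTE sE).
move/subset_leq_card => le2; have le3 := leq_trans le (leq_trans le2 (leq_card_setU _ _)).
have := cardsID B A; rewrite (setIidPr BA) => h.
by move: le3; rewrite -h [leqLHS]addnC leq_add2l.
Qed.

Lemma segX2_neq a : a \in A -> next c (segX a) != segX a.
Proof.
by move=> aA; rewrite eq_sym; apply: adj_neq; have [_ cy _ _ _] := g;
  apply: next_cycle; rewrite // /segX mem_next Ac.
Qed.

(** In a segment of two vertices the last is the second successor of [a], which [next2_indep] keeps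
    from every other [segX b]. Hence a vertex that is neither end is left for [seg_count]. *)
Lemma chordY_segX2 a : a \in A -> chordY a -> next c (segX a) != segY a.
Proof.
move=> aA /existsP [b /and3P [bA ba e]]; apply/eqP => E.
by have := next2_indep g aA bA; rewrite eq_sym ba -/(segX a) E adj_sym e => /(_ isT).
Qed.

(** Otherwise [seg_count] fails with the end [segY a] against the missed [succA a] and [b]. A chord
    into [segX a] adds one to each side, the missed vertex being [a]. *)
Lemma chord_next a b : a \in A -> b \in A -> b != a -> segY a -- segX b -> b = succA a.
Proof.
move=> aA bA ba chord; apply/eqP/negPn/negP => bs.
have ab : a != b by rewrite eq_sym.
have cY : chordY a by apply/existsP; exists b; rewrite bA ba.
have sB z : z \in seg a -> z != segY a -> ~~ z -- succA a /\ ~~ z -- b.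
  by move=> zs zY; rewrite (chord_succA_left aA bA ab chord) // (chord_left aA bA ab chord).
case: (boolP (chordX a)) => [/existsP [d /and3P [dA da ch']]|nX].
  have sB' z : z \in seg a -> z != segX a -> ~~ z -- a.
    by move=> zs zX; apply: (chord_right dA aA da ch').
  have : #|[set succA a; b; a]| <= #|[set segX a; segY a]|.
    apply: (@seg_count a _ _ (next c (segX a))); rewrite ?subxx ?segX2_in //.
    - by rewrite !inE eqxx.
    - by rewrite !inE eqxx orbT.
    - by rewrite !subUset !sub1set aA bA succA_in.
    - by rewrite !inE negb_or segX2_neq // chordY_segX2.
    move=> v e vs; rewrite !inE negb_or => /andP [vX vY].
    have [h1 h2] := sB _ vs vY; have h3 := sB' _ vs vX.
    by case/orP=> [/orP [] /eqP ->|/eqP ->].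
  rewrite cards2 (segX_neq_segY aA) -setUA cardsU1 cards2 !inE negb_or ba.
  by rewrite (eq_sym _ b) bs succA_neq.
have : #|[set succA a; b]| <= #|[set segY a]|.
  apply: (@seg_count a _ _ (segX a)); rewrite ?segX_in //.
  - by rewrite sub1set !inE eqxx orbT.
  - by rewrite (negbTE nX).
  - by rewrite !inE.
  - by rewrite !subUset !sub1set bA succA_in.
  - by rewrite !inE segX_neq_segY.
  move=> v e vs; rewrite !inE => vY; have [h1 h2] := sB _ vs vY.
  by case/orP => /eqP ->.
by rewrite cards1 cards2 eq_sym bs.
Qed.

(** A third segment [sej j] misses [succA a] entirely. Each kind of chord at [j] adds one end to [E]
    and one missed vertex to [B], [j] or [succA j], so [B] always stays one ahead. *)
Lemma no_chord a b : a \in A -> b \in A -> b != a -> ~~ segY a -- segX b.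
Proof.
move=> aA bA ba; apply/negP => chord; have bs := chord_next aA bA ba chord.
rewrite {}bs {b bA ba} in chord.
have [j] : exists j, j \in A :\: [set a; succA a].
  apply/set0Pn; rewrite -card_gt0; have := cardsID [set a; succA a] A.
  rewrite (setIidPr _) ?subUset ?sub1set ?aA ?succA_in // cards2.
  by rewrite eq_sym succA_neq //; move: A3; lia.
rewrite !inE negb_or => /andP [/andP [ja js] jA].
have far (q : G) : q \in seg j -> ~~ q -- succA a by move=> qs; apply: (chord_far aA jA ja js chord qs).
have ss : succA j != succA a by apply: contra ja => /eqP /(succA_inj jA aA) ->.
have sj := succA_neq jA.
have hY z : chordY j -> z \in seg j -> z != segY j -> ~~ z -- succA j.
  move=> /existsP [d /and3P [dA dj ch]] zs zY; rewrite eq_sym in dj.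
  exact: (chord_succA_left jA dA dj ch).
have hX z : chordX j -> z \in seg j -> z != segX j -> ~~ z -- j.
  move=> /existsP [d /and3P [dA dj ch]] zs zX.
  exact: (chord_right dA jA dj ch).
have sA := succA_in aA; have sjA := succA_in jA.
case: (boolP (chordX j)) => cX; case: (boolP (chordY j)) => cY.
- have : #|[set succA a; succA j; j]| <= #|[set segX j; segY j]|.
    apply: (@seg_count j _ _ (next c (segX j))); rewrite ?subxx ?segX2_in //.
    - by rewrite !inE eqxx.
    - by rewrite !inE eqxx orbT.
    - by rewrite !subUset !sub1set jA sA sjA.
    - by rewrite !inE negb_or segX2_neq // chordY_segX2.
    move=> v e vs; rewrite !inE negb_or => /andP [vX vY].
    have h1 := hX _ cX vs vX; have h2 := hY _ cY vs vY; have h3 := far _ vs.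
    by case/orP=> [/orP [] /eqP ->|/eqP ->].
  rewrite cards2 (segX_neq_segY jA) -setUA cardsU1 cards2 !inE negb_or sj.
  by rewrite !(eq_sym (succA a)) ss js.
- have : #|[set succA a; j]| <= #|[set segX j]|.
    apply: (@seg_count j _ _ (next c (segX j))); rewrite ?segX2_in //.
    - by rewrite sub1set !inE eqxx.
    - by rewrite !inE.
    - by rewrite (negbTE cY).
    - by rewrite !subUset !sub1set jA sA.
    - by rewrite !inE segX2_neq.
    move=> v e vs; rewrite !inE => vX; have h1 := hX _ cX vs vX; have h3 := far _ vs.
    by case/orP => /eqP ->.
  by rewrite cards1 cards2 eq_sym js.
- have : #|[set succA a; succA j]| <= #|[set segY j]|.
    apply: (@seg_count j _ _ (segX j)); rewrite ?segX_in //.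
    - by rewrite sub1set !inE eqxx orbT.
    - by rewrite (negbTE cX).
    - by rewrite !inE.
    - by rewrite !subUset !sub1set sjA sA.
    - by rewrite !inE segX_neq_segY.
    move=> v e vs; rewrite !inE => vY; have h1 := hY _ cY vs vY; have h3 := far _ vs.
    by case/orP => /eqP ->.
  by rewrite cards1 cards2 eq_sym ss.
have : #|[set succA a]| <= #|@set0 G|; last by rewrite cards0 cards1.
apply: (@seg_count j _ _ (segX j)); rewrite ?sub0set ?segX_in ?(negbTE cX) ?(negbTE cY) ?inE //.
  by rewrite sub1set.
by move=> v e vs _; rewrite !inE => /eqP ->; apply: far.
Qed.

Lemma seg_anticomplete a b (q q' : G) : a \in A -> b \in A -> q \in seg a -> q' \in seg b ->
  q -- q' -> a = b.
Proof.
move=> aA bA qs q's e; apply/eqP/negPn/negP => ab.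
have ba : b != a by rewrite eq_sym.
case: (cross_chord aA bA ab qs q's e) => [] [E1 E2]; rewrite E1 E2 in e.
  by have := no_chord aA bA ba; rewrite e.
by have := no_chord bA aA ab; rewrite adj_sym e.
Qed.

(** * Toughness *)

Lemma good_absurd : False.
Proof.
have [a0 a0A] : exists a, a \in A by apply/card_gt0P; move: A3; lia.
have n0 := succA_neq a0A.
have [h0 [s [? [gs _ _ _ [_ sH]]]]] := link (succA_in a0A) a0A n0.
have {}h0H : h0 \in H by apply: sH; have /andP [] := walk_mem gs.
have hC h : h \in H -> h \in ~: A.
  by rewrite inE => hH; apply/negP => hA; move: AH; rewrite disjoints_subset => /subsetP /(_ _ hA); rewrite inE hH.
have xC a : a \in A -> segX a \in ~: A.
  by move=> aA; have := next_W g aA; rewrite in_W inE => /andP [].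
pose D := del_vertices A.
(* This label is constant on the components of [D] and takes [#|A|.+1] values, which bounds the
   number of components from below without determining them. *)
pose own (v : G) := [pick a in A | v \in seg a].
have ownE a v : a \in A -> v \in seg a -> own v = Some a.
  move=> aA vs; rewrite /own; case: pickP => [b /andP [bA vb]|/(_ a)]; last by rewrite /= aA vs.
  by rewrite (seg_disj aA bA vs vb).
have ownH h : h \in H -> own h = None.
  move=> hH; rewrite /own; case: pickP => // b /andP [bA hb].
  by have := seg_W bA hb; rewrite in_W hH andbF.
have own_adj (u v : D) : u -- v -> own (val u) = own (val v).
  move=> e; have {}e : val u -- val v by [].
  have uA : val u \notin A by have := valP u; rewrite inE.
  have vA : val v \notin A by have := valP v; rewrite inE.
  case: (boolP (val u \in H)) => uH.
    rewrite adj_sym in e; have := nbrH uH e; rewrite inE (negbTE vA) /= => vH.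
    by rewrite !ownH.
  case: (boolP (val v \in H)) => vH.
    by have := nbrH vH e; rewrite inE (negbTE uA) (negbTE uH).
  have uW : val u \in W by rewrite in_W uA uH.
  have vW : val v \in W by rewrite in_W vA vH.
  have [a aA ua] := seg_cover uW; have [b bA vb] := seg_cover vW.
  by rewrite (ownE a) // (ownE b) // (seg_anticomplete aA bA ua vb e).
have own_conn (u v : D) : connect (@adj D) u v -> own (val u) = own (val v).
  move=> /connectP [p P ->] {v}; elim: p u P => //= v p IH u /andP [e /IH <-].
  exact: own_adj.
pose rep (o : option G) : D :=
  (* The default of [insubd] is returned only for [a] with [segX a] in [A], which no [a] in [A]
     satisfies. *)
  if o is Some a then insubd (Sub h0 (hC _ h0H) : D) (segX a) else Sub h0 (hC _ h0H).
have repE o : o \in None |: [set Some a | a in A] -> own (val (rep o)) = o.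
  rewrite inE => /orP [/set1P ->|/imsetP [a aA ->]]; first by rewrite /= ownH.
  by rewrite /rep val_insubd xC // (ownE a) // segX_in.
pose blk (o : option G) := [set y in [set: D] | connect (@adj D) (rep o) y].
have blk_inj : {in None |: [set Some a | a in A] &, injective blk}.
  move=> o o' oI oI' E; rewrite -(repE o) // -(repE o') //; apply: own_conn.
  have : rep o' \in blk o' by rewrite !inE connect0.
  by rewrite -E !inE.
have card : #|None |: [set Some a | a in A]| = #|A|.+1.
  rewrite cardsU1 card_imset; last by move=> ? ? [].
  by case: imsetP => // [[]].
have le : #|A|.+1 <= omega D.
  rewrite -card -(card_in_imset blk_inj); apply: subset_leq_card.
  apply/subsetP => ? /imsetP [o _ ->]; apply/imsetP; exists (rep o) => //.
have : omega D <= #|A| by apply: tough; apply: leq_trans le; move: A3; lia.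
by move=> /(leq_trans le); rewrite ltnn.
Qed.
End Segments.
End Core.

(** * The graph hypotheses *)

Lemma free_embed (K G : sgraph) (e : K -> G) : free_of K G -> injective e ->
  ~ (forall x y, adj (e x) (e y) = adj x y).
Proof.
move=> fr ie he; pose B := [set v in codom e].
have Bc (x : induced B) : val x \in codom e by have := valP x; rewrite inE.
apply: (fr B); exists (fun x => iinv (Bc x)).
  have eB y : e y \in B by rewrite inE codom_f.
  exists (fun y => Sub (e y) (eB y)) => x.
    by apply: val_inj; rewrite /= f_iinv.
  by apply: ie; rewrite f_iinv.
by move=> x y; rewrite -he !f_iinv.
Qed.

Lemma free_indep (G : sgraph) k (z z' : G) (I : {set G}) :
  free_of (P2_kP1 k) G -> z -- z' -> {in I, forall v, [&& v != z, v != z', ~~ v -- z & ~~ v -- z']} ->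
  {in I &, forall u v, ~~ u -- v} -> #|I| < k.
Proof.
move=> fr e Iz II; rewrite ltnNge; apply/negP => kI.
pose f (x : P2_kP1 k) : G :=
  match x with inl i => if i == ord0 then z else z' | inr p => nth z (enum I) p.1 end.
have fI p : f (inr p) \in I.
  by rewrite /= -mem_enum mem_nth // -cardE; apply: leq_trans kI.
have zz' : z != z' by apply/eqP => E; rewrite E adj_irr in e.
have o1 (u v : path_graph 1) : u -- v = false by case: u v => [[|//] ?] [[|//] ?].
have o1e (u v : path_graph 1) : u = v by apply: val_inj; case: u v => [[|//] ?] [[|//] ?].
apply: (free_embed (e := f) fr).
- move=> [i|p] [j|q] E.
  + congr inl; apply: val_inj; move: E => /=.
    case: i j => [[|[|//]] hi] [[|[|//]] hj] //= /eqP; rewrite ?(negbTE zz') //.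
    by rewrite eq_sym (negbTE zz').
  + have /and4P [n1 n2 _ _] := Iz _ (fI q); move: n1 n2; rewrite -E /=.
    by case: ifP; rewrite eqxx.
  + have /and4P [n1 n2 _ _] := Iz _ (fI p); move: n1 n2; rewrite E /=.
    by case: ifP; rewrite eqxx.
  congr inr; case: p q E => [i u] [j v] /= /eqP; rewrite nth_uniq ?enum_uniq //.
  - by move=> /eqP /val_inj ->; rewrite (o1e u v).
  - by rewrite -cardE; apply: leq_trans kI.
  by rewrite -cardE; apply: leq_trans kI.
move=> [i|p] [j|q].
- case: i j => [[|[|//]] hi] [[|[|//]] hj] //=; rewrite ?adj_irr //.
  by rewrite adj_sym e.
- have /and4P [_ _ n1 n2] := Iz _ (fI q); rewrite adj_sym; apply/negbTE.
  by rewrite {2}/f; case: ifP.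
- have /and4P [_ _ n1 n2] := Iz _ (fI p); apply/negbTE.
  by rewrite {2}/f; case: ifP.
rewrite (negbTE (II _ _ (fI p) (fI q))).
case: p q => [i u] [j v]; symmetry.
by rewrite -[RHS](andbF (i == j)) -(o1 u v).
Qed.

Definition nbrs (G : sgraph) (S : {set G}) := [set v | (v \notin S) && [exists s in S, s -- v]].

(** A path that avoids [nbrs S] never leaves [S], so deleting [nbrs S] separates [s] from [z]. *)
Lemma connected_sep (G : sgraph) k (S : {set G}) (s z : G) : kconnected k G ->
  s \in S -> z \notin S -> z \notin nbrs S -> k <= #|nbrs S|.
Proof.
move=> [_ kc] sS zS zN; rewrite leqNgt; apply/negP => /kc; rewrite /connected /omega.
have sC : s \in ~: nbrs S by rewrite !inE sS.
have zC : z \in ~: nbrs S by rewrite inE.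
set D := del_vertices _ => c1.
pose s' : D := Sub s sC; pose z' : D := Sub z zC.
have : connect (@adj D) s' z'.
  have /eqP/cards1P [B EB] := c1.
  have blk (x : D) : [set y in [set: D] | connect (@adj D) x y] = B.
    apply/set1P; rewrite -EB; apply/imsetP; exists x => //.
  have : z' \in B by rewrite -(blk z') !inE connect0.
  by rewrite -(blk s') !inE.
move=> /connectP [p P L].
have sS' : val s' \in S by [].
have : val (last s' p) \in S.
  elim: p s' {L} P sS' => [|v p IH] u //= /andP [e P] uS; apply: IH => //.
  have := valP v; rewrite !inE negb_and negbK => /orP [//|].
  by move/existsP => []; exists (val u); rewrite uS.
by rewrite -L /= (negbTE zS).
Qed.

Theorem theorem2 (k : nat) (G : sgraph) :
  4 <= k -> one_tough G -> kconnected k.-1 G -> free_of (P2_kP1 k) G ->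
  forall c : seq G, longest_cycle c -> edge_dominating_cycle c.
Proof.
move=> k4 tough kc fr c [cyc lng]; split=> // D DC; apply/eqP/negPn/negP => D1.
have [/andP [cy uc] sc] := cyc.
have [x0 _ ED] := imsetP DC.
pose H := [set val y | y in D].
have HP v : v \in H -> v \notin c.
  by case/imsetP=> y _ ->; have := valP y; rewrite !inE.
have Dconn (y y' : del_vertices [set x in c]) : y \in D -> y -- y' -> y' \in D.
  rewrite ED !inE => h e; exact: connect_trans h (connect1 e).
have nH v h : h \in H -> v -- h -> v \notin c -> v \in H.
  case/imsetP=> y yD -> e vc; have vC : v \in ~: [set x in c] by rewrite !inE.
  apply/imsetP; exists (Sub v vC) => //; apply: Dconn yD _.
  by rewrite /adj /= /induced_rel /= adj_sym.
have Hpath u v : u \in H -> v \in H ->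
    exists s, [/\ walk u s v, uniq s & {subset s <= H}].
  case/imsetP=> y yD -> /imsetP [y' y'D ->].
  have : connect (@adj (del_vertices [set x in c])) y y'.
    have cs : connect_sym (@adj (del_vertices [set x in c])).
      by apply: sym_connect_sym; apply: adj_sym.
    move: yD y'D; rewrite ED !inE => h h'; apply: connect_trans h'.
    by rewrite cs.
  case/connectP=> p0 P0 ->; case/shortenP: P0 => p P U _.
  exists (map val (y :: p)); split.
  - rewrite /= eqxx last_map eqxx andbT /=.
    elim: p y P {U yD} => //= z p IH y /andP [e P]; rewrite IH // andbT; exact: e.
  - by rewrite map_inj_uniq //; apply: val_inj.
  move=> w /mapP [z zp ->]; apply: imset_f.
  elim: p y yD P zp {U} => [|z' p IH] y yD /=; first by move=> _; rewrite inE => /eqP ->.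
  case/andP=> e P; rewrite inE => /orP [/eqP ->//|]; apply: IH P => //.
  exact: Dconn yD e.
have H2 : 1 < #|H|.
  rewrite card_imset; last exact: val_inj.
  have : 0 < #|D| by apply/card_gt0P; exists x0; rewrite ED !inE connect0.
  by move: D1; case: #|D| => [|[]].
pose A := nbrs H.
have Ac : {subset A <= c}.
  move=> a; rewrite inE => /andP [aH /existsP [h /andP [hH e]]].
  apply/negPn/negP => ac; move: aH; rewrite (nH a h) //; by rewrite adj_sym.
have AH : [disjoint A & H].
  by rewrite disjoints_subset; apply/subsetP => a; rewrite !inE => /andP [].
have nbrH v h : h \in H -> v -- h -> v \in A :|: H.
  move=> hH e; rewrite !inE; case: (boolP (v \in H)) => vH; rewrite ?orbT // orbF.
  by apply/existsP; exists h; rewrite hH adj_sym.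
have N3 : 2 < size c by [].
have longest (s : seq G) : uniq s -> cycle (@adj G) s -> 2 < size s -> size s <= size c.
  by move=> us cs ss; apply: lng; split=> //; apply/andP.
have Anbr a : a \in A -> exists2 h, h \in H & a -- h.
  rewrite inE => /andP [_ /existsP [h /andP [hH e]]]; exists h => //.
  by rewrite adj_sym.
have link1 a b : a \in A -> b \in A -> a != b ->
    exists u s v, [/\ walk u s v, a -- u, v -- b, uniq s & {subset s <= H}].
  move=> /Anbr [u uH eu] /Anbr [v vH ev] _; have [s [gs us sH]] := Hpath u v uH vH.
  by exists u, s, v; rewrite [v -- b]adj_sym.
have g : good (size c) H A c.
  split=> // v vc; apply/negP => /HP; by rewrite vc.
have [h0 h0H] : exists h, h \in H by apply/card_gt0P; apply: leq_trans H2.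
have tA : k.-1 <= #|A|.
  (* [A] separates only if something lies beyond it; [next_W] excludes a cycle contained in [A]. *)
  suff [z zc zA] : exists2 z, z \in c & z \notin A.
    apply: (connected_sep kc h0H (z := z)) => //.
    by apply/negP => /HP; rewrite zc.
  case: (boolP (all (mem A) c)) => [/allP cA|/allPn [z zc zA]]; last by exists z.
  have [a0 a0c] : exists a, a \in c by case: (c) sc => // a; exists a; rewrite inE eqxx.
  exists (next c a0); first by rewrite mem_next.
  by have := next_W N3 longest link1 g (cA _ a0c); rewrite in_W => /andP [].
have WH v h : v \in ~: (A :|: H) -> h \in H -> ~~ v -- h.
  by rewrite inE => vW hH; apply: contra vW; apply: nbrH.
(* The first edge of a path in [H]; it serves as the [P2] in [indep_bound]. *)
have [h1 h1H e01] : exists2 h1, h1 \in H & h0 -- h1.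
  have [h2 h2H n2] : exists2 h2, h2 \in H & h2 != h0.
    have : 0 < #|H :\ h0| by move: H2; rewrite (cardsD1 h0) h0H add1n ltnS.
    by case/card_gt0P => h2; rewrite !inE => /andP [? ?]; exists h2.
  have [[|z [|z' s]] [//= gs us sH]] := Hpath h0 h2 h0H h2H.
    by case/andP: gs => /eqP E1 /eqP E2; move: n2; rewrite -E2 E1 eqxx.
  case/and3P: gs => /eqP <- /andP [e _] _.
  by exists z' => //; apply: sH; rewrite !inE eqxx orbT.
have indep_bound (I : {set G}) : {subset I <= ~: (A :|: H)} ->
    {in I &, forall u v, ~~ u -- v} -> #|I| < k.
  move=> IW II; apply: (free_indep fr e01 _ II) => v vI.
  have vW := IW _ vI; rewrite !WH // !andbT.
  by apply/andP; split; apply/eqP => E; move: vW; rewrite E !inE ?h0H ?h1H orbT.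
(* The upper bound comes from the successors of [A], which are [#|A|] independent vertices away from
   [h0 -- h1]. *)
have At : #|A| = k.-1.
  apply/eqP; rewrite eqn_leq tA andbT.
  have inj : injective (next c) by exact: can_inj (prev_next uc).
  have : #|[set next c a | a in A]| < k; last first.
    by rewrite card_imset // => lt; rewrite -ltnS prednK //; apply: leq_trans k4.
  apply: indep_bound => [v /imsetP [a aA ->]|u v /imsetP [a aA ->] /imsetP [b bA ->]].
    exact: (next_W N3 longest link1 g aA).
  case: (altP (a =P b)) => [->|ab]; first by rewrite adj_irr.
  exact: (next_indep N3 longest link1 g aA bA ab).
have link a b : a \in A -> b \in A -> a != b ->
    exists u s v, [/\ walk u s v, a -- u, v -- b, 1 < size s & uniq s /\ {subset s <= H}].
  move=> aA bA ab.
  have long u v : u \in H -> v \in H -> u != v -> a -- u -> b -- v ->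
      exists u s v, [/\ walk u s v, a -- u, v -- b, 1 < size s & uniq s /\ {subset s <= H}].
    move=> uH vH uv eu ev; have [s [gs us sH]] := Hpath u v uH vH.
    exists u, s, v; rewrite [v -- b]adj_sym; split=> //.
    move: gs; case: (s) => [|z [|//]] // /and3P [/eqP -> _ /eqP E].
    by rewrite -E eqxx in uv.
  have [u uH eu] := Anbr a aA; have [v vH ev] := Anbr b bA.
  case: (altP (u =P v)) => [uv|uv]; last exact: (long u v).
  case: (boolP [exists w in H, (w != u) && (a -- w || b -- w)]).
    case/existsP=> w /and3P [wH wu /orP [] e]; first by apply: (long w v) => //; rewrite -uv.
    by apply: (long u w) => //; rewrite eq_sym.
  (* Now [u] is the only neighbour of [a] and of [b] in [H], so [u] together with [A] minus [a] and
     [b], fewer than [k.-1] vertices, separates the rest of [H] from [a]. *)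
  move/existsPn => only; exfalso.
  have [w wH wu] : exists2 w, w \in H & w != u.
    have : 0 < #|H :\ u| by move: H2; rewrite (cardsD1 u) uH add1n ltnS.
    by case/card_gt0P => w; rewrite !inE => /andP [? ?]; exists w.
  have wS : w \in H :\ u by rewrite !inE wu.
  have aS : a \notin H :\ u by rewrite !inE negb_and; move: aA; rewrite inE => /andP [-> _]; rewrite orbT.
  have far d z : (d == a) || (d == b) -> z \in H :\ u -> ~~ z -- d.
    rewrite !inE => hd /andP [zu zH]; apply/negP => e; rewrite adj_sym in e.
    by have := only z; rewrite zH zu /=; case/orP: hd e => /eqP -> ->; rewrite ?orbT.
  have aN : a \notin nbrs (H :\ u).
    rewrite inE aS /=; apply/existsPn => z; apply/negP => /andP [zS e].
    by have := far a z; rewrite eqxx zS e => /(_ isT isT).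
  have := connected_sep kc wS aS aN.
  have : nbrs (H :\ u) \subset u |: (A :\: [set a; b]).
    apply/subsetP => z; rewrite inE => /andP [zS /existsP [y /andP [yS e]]].
    have yH : y \in H by move: yS; rewrite !inE => /andP [].
    rewrite in_setU1 in_setD !inE; case: (altP (z =P u)) => //= zu.
    have zH : z \notin H by move: zS; rewrite !inE zu.
    rewrite zH /=; apply/andP; split.
      by apply/negP => zab; have := far z y zab yS; rewrite e.
    by apply/existsP; exists y; rewrite yH.
  move/subset_leq_card => le1 le2; have := leq_trans le2 le1.
  rewrite cardsU1 -At; have := cardsID [set a; b] A.
  rewrite (setIidPr _) ?subUset ?sub1set ?aA ?bA // cards2 ab => <-.
  by rewrite leq_add2r; case: (_ \notin _).
have card_rep f : rep_system H A f -> #|[set f a | a in A]| = #|A|.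
  move=> [_ fI]; apply: card_in_imset => a b aA bA E; apply/eqP/negPn/negP => ab.
  by have [/eqP] := fI _ _ aA bA ab.
have rep_indep f : rep_system H A f -> {in [set f a | a in A] &, forall u v, ~~ u -- v}.
  move=> [_ fI] _ _ /imsetP [a aA ->] /imsetP [b bA ->].
  case: (altP (a =P b)) => [->|ab]; first by rewrite adj_irr.
  by have [] := fI _ _ aA bA ab.
apply: (@good_absurd G (size c) H A N3 _ longest link AH _ _ nbrH _ tough c g).
- by rewrite At -ltnS prednK //; apply: leq_trans k4.
- move=> f fs u uW.
  case: (boolP [exists a in A, (u == f a) || u -- f a]) => [/existsP [a /andP [aA h]]|/existsPn no].
    by exists a.
  have no' a : a \in A -> u != f a /\ ~~ u -- f a.
    by move=> aA; have := no a; rewrite aA /= negb_or => /andP.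
  exfalso; have : #|u |: [set f a | a in A]| < k.
    apply: indep_bound => [v|v v'].
      rewrite in_setU1 => /orP [/eqP -> //|/imsetP [a aA ->]]; by case: fs => h _; apply: h.
    rewrite !in_setU1 => /orP [/eqP ->|vI] /orP [/eqP ->|v'I]; rewrite ?adj_irr //.
    - by case/imsetP: v'I => a aA ->; case: (no' a aA).
    - by case/imsetP: vI => a aA ->; rewrite adj_sym; case: (no' a aA).
    exact: (rep_indep f fs).
  rewrite cardsU1 (card_rep f fs) At.
  have -> : u \notin [set f a | a in A].
    by apply/negP => /imsetP [a aA E]; have [] := no' a aA; rewrite E eqxx.
  by move: k4; clear; lia.
- move=> f fs z z' zW z'W e.
  case: (boolP [exists a in A, [|| f a == z, f a == z', f a -- z | f a -- z']]).
    by case/existsP=> a /andP [aA h]; exists a.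
  move/existsPn=> no; exfalso.
  have : #|h0 |: [set f a | a in A]| < k.
    have fH v : v \in [set f a | a in A] -> ~~ v -- h0.
      by case/imsetP=> a aA ->; apply: WH => //; case: fs => h _; apply: h.
    apply: (free_indep fr e) => [v|v v'].
      rewrite in_setU1 => /orP [/eqP ->|/imsetP [a aA ->]].
        rewrite ![h0 -- _]adj_sym !WH // !andbT.
        by apply/andP; split; apply/eqP => E; [move: zW | move: z'W]; rewrite -E !inE h0H orbT.
      by have := no a; rewrite aA /= !negb_or.
    rewrite !in_setU1 => /orP [/eqP ->|vI] /orP [/eqP ->|v'I]; rewrite ?adj_irr //.
    - by rewrite adj_sym fH.
    - by rewrite fH.
    exact: (rep_indep f fs).
  rewrite cardsU1 (card_rep f fs) At.
  have -> : h0 \notin [set f a | a in A].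
    apply/negP => /imsetP [a aA E]; case: fs => h _; have := h a aA.
    by rewrite -E !inE h0H orbT.
  by move: k4; clear; lia.
(* [h0] is neither in [S] nor adjacent to it, so [nbrs S] is a separator. *)
move=> S SW /set0Pn [s sS]; rewrite At; apply: (connected_sep kc sS (z := h0)).
  by apply/negP => hS; have := subsetP SW _ hS; rewrite !inE h0H orbT.
rewrite inE negb_and; apply/orP; right; apply/existsPn => v; rewrite negb_and.
by case: (boolP (v \in S)) => //= vS; apply: WH => //; apply: (subsetP SW).
Qed.
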